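(* Let $f : X \to Y$ be a simplicially crisp map between $0$-skeletal types, and let $\check{\mathsf C}(f) := \sum_{y:Y}\mathrm{csk}\big(\sum_{x:X}(fx=y)\big)$ be its Čech complex. Then for every $n$ the type of $n$-simplices $\check{\mathsf C}(f)_n := \mathrm{sk}(\Delta[n]\to\check{\mathsf C}(f))$ satisfies $$\check{\mathsf C}(f)_n \simeq X\times_Y\cdots\times_Y X \simeq \sum_{y:Y}\Big(\sum_{x:X}(fx=y)\Big)^{n+1},$$ that is, it is the $(n+1)$-fold pullback of $f$ along itself.
   Context: TYPE THEORY. Homotopy type theory with one focus, the simplicial focus (Shulman's spatial type theory with $\flat,\sharp$ written $\mathrm{sk},\mathrm{csk}$). Contexts contain ordinary variables $x:X$ and simplicially crisp variables $x::X$, whose types may depend only on crisp variables; a term or type is simplicially crisp if it and its type use only crisp free variables, and only crisp terms may be substituted for crisp variables. For a crisp type $A$ there is a type $\mathrm{sk}A$ with $a^{\mathrm{sk}}:\mathrm{sk}A$ for crisp $a::A$; to define something for $u:\mathrm{sk}A$ one may assume $u\equiv a^{\mathrm{sk}}$ with $a::A$; the counit $\mathrm{sk}A\to A$ sends $a^{\mathrm{sk}}$ to $a$. In forming $\mathrm{csk}A$ and $a^{\mathrm{csk}}:\mathrm{csk}A$ all variables may be used as if crisp; a crisp $u::\mathrm{csk}A$ yields $u_{\mathrm{csk}}:A$, with $(a^{\mathrm{csk}})_{\mathrm{csk}}\equiv a$ and $(u_{\mathrm{csk}})^{\mathrm{csk}}\equiv u$. $\mathrm{csk}$ is a lex modality,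 $\mathrm{sk}$ a lex idempotent comodality, and $\mathrm{sk}(\mathrm{sk}A\to B)\simeq\mathrm{sk}(A\to\mathrm{csk}B)$ for crisp $A,B$. A crisp type is $0$-skeletal if its $\mathrm{sk}$-counit is an equivalence. SIMPLICIAL AXIOMS. $\Delta[1]$ is a totally ordered type with a $\mathbf{Prop}$-valued order (reflexive, transitive, antisymmetric, and $x\le y$ or $y\le x$ for all $x,y$), with least element $0$, greatest element $1$ and $0\ne1$; $\Delta[n]:=\{\vec x:\Delta[1]^n\mid x_1\le\dots\le x_n\}$. A simplicially crisp type is $0$-skeletal iff it is $\Delta[1]$-null (every map $\Delta[1]\to X$ is constant), and $\mathrm{re}$ (realization) is the nullification at $\Delta[1]$. The $\Delta[n]$ detect simplicial continuity: a crisp $f:X\to Y$ is $\mathrm{csk}$-modal iff for every $n$ the square with corners $\mathrm{sk}(X^{\Delta[n]}),\mathrm{sk}(X^{\mathrm{sk}\Delta[n]}),\mathrm{sk}(Y^{\Delta[n]}),\mathrm{sk}(Y^{\mathrm{sk}\Delta[n]})$ (precomposition with the counit, postcomposition with $f$) is a pullback. For $i:\Delta[1]$, $\mathrm{csk}((i=0)\vee(i=1))$ holds. Each $\Delta[n]$ is crisply projective: for crisp $E:\Delta[n]\to\mathbf{Type}$ there is a map $\mathrm{sk}(\prod_{i}\|E_i\|)\to\|\mathrm{sk}(\prod_{i}E_i)\|$. *)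

(* Defs.v *)
From Stdlib Require Import List.
Import ListNotations.

(** * A deep embedding of homotopy type theory with a simplicial focus

    Raw terms use de Bruijn indices.  [n] binders are opened in the arguments
    marked [^n] below, the last one bound being index [0].

      [Pi A B^1], [Lam A t^1], [Sig A B^1]
      [Split C^1 t^2 p]         sum induction
      [Case C^1 l^1 r^1 s]      coproduct induction
      [NatInd C^1 z s^2 n]      the branch [s] binds the predecessor, then the
                                inductive hypothesis
      [J C^2 c p]               based path induction, the motive binding the
                                endpoint, then the path
      [SkLet C^1 N^1 M]         [let u^sk := M in N], where [u] is crisp in [N] *)

(** Non-logical axioms; [axiom_type] gives their types.  That [csk] is a lex
    modality, that [sk] is a lex idempotent comodality and that they are adjoint
    follows from the rules and is not postulated. *)
Inductive axiom : Set :=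
| Funext (i : nat)
| Univalence (i : nat)
| LeProp | LeRefl | LeTrans | LeAntisym | LeTotal | LeLeast | LeGreatest
| EndpointsDistinct
| SkeletalIffNull (i : nat)
| DetectContinuity (i : nat)
| EndpointsCsk
| CrispProjective (i : nat).

Inductive term : Set :=
| Var (k : nat)
| Univ (i : nat)
| Pi (A B : term) | Lam (A t : term) | App (f a : term)
| Sig (A B : term) | Pair (a b : term) | Split (C t p : term)
| Coprod (A B : term) | Inl (a : term) | Inr (b : term) | Case (C l r s : term)
| Unit | Tt | UnitInd (C t u : term)
| Empty | EmptyInd (C e : term)
| Nat | Zero | Succ (n : term) | NatInd (C z s n : term)
| Id (A a b : term) | Refl (a : term) | J (C c p : term)
| Trunc (A : term) | TrIn (a : term) | TrPath (x y : term) | TrRec (h f t : term)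
| Sk (A : term) | SkIn (a : term) | SkLet (C N M : term)
| Csk (A : term) | CskIn (a : term) | CskOut (u : term)
| Delta1 | D0 | D1 | Le (x y : term)
| Ax (c : axiom).

(** ** Renaming and substitution *)

Definition up_ren (r : nat -> nat) (k : nat) : nat :=
  match k with 0 => 0 | S k => S (r k) end.

Fixpoint ren (r : nat -> nat) (t : term) : term :=
  let r1 := up_ren r in
  let r2 := up_ren r1 in
  match t with
  | Var k => Var (r k)
  | Univ i => Univ i
  | Pi A B => Pi (ren r A) (ren r1 B)
  | Lam A t => Lam (ren r A) (ren r1 t)
  | App f a => App (ren r f) (ren r a)
  | Sig A B => Sig (ren r A) (ren r1 B)
  | Pair a b => Pair (ren r a) (ren r b)
  | Split C t p => Split (ren r1 C) (ren r2 t) (ren r p)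
  | Coprod A B => Coprod (ren r A) (ren r B)
  | Inl a => Inl (ren r a)
  | Inr b => Inr (ren r b)
  | Case C l r' s => Case (ren r1 C) (ren r1 l) (ren r1 r') (ren r s)
  | Unit => Unit
  | Tt => Tt
  | UnitInd C t u => UnitInd (ren r1 C) (ren r t) (ren r u)
  | Empty => Empty
  | EmptyInd C e => EmptyInd (ren r1 C) (ren r e)
  | Nat => Nat
  | Zero => Zero
  | Succ n => Succ (ren r n)
  | NatInd C z s n => NatInd (ren r1 C) (ren r z) (ren r2 s) (ren r n)
  | Id A a b => Id (ren r A) (ren r a) (ren r b)
  | Refl a => Refl (ren r a)
  | J C c p => J (ren r2 C) (ren r c) (ren r p)
  | Trunc A => Trunc (ren r A)
  | TrIn a => TrIn (ren r a)
  | TrPath x y => TrPath (ren r x) (ren r y)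
  | TrRec h f t => TrRec (ren r h) (ren r f) (ren r t)
  | Sk A => Sk (ren r A)
  | SkIn a => SkIn (ren r a)
  | SkLet C N M => SkLet (ren r1 C) (ren r1 N) (ren r M)
  | Csk A => Csk (ren r A)
  | CskIn a => CskIn (ren r a)
  | CskOut u => CskOut (ren r u)
  | Delta1 => Delta1
  | D0 => D0
  | D1 => D1
  | Le x y => Le (ren r x) (ren r y)
  | Ax c => Ax c
  end.

Definition wk (n : nat) (t : term) : term := ren (Nat.add n) t.

Notation "# k" := (Var k) (at level 2, k at level 1, format "# k").
Notation "t ↑ n" := (wk n t) (at level 3, n at level 1, left associativity,
  format "t ↑ n").

Definition up (s : nat -> term) (k : nat) : term :=
  match k with 0 => #0 | S k => (s k)↑1 end.

Fixpoint subst (s : nat -> term) (t : term) : term :=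
  let s1 := up s in
  let s2 := up s1 in
  match t with
  | Var k => s k
  | Univ i => Univ i
  | Pi A B => Pi (subst s A) (subst s1 B)
  | Lam A t => Lam (subst s A) (subst s1 t)
  | App f a => App (subst s f) (subst s a)
  | Sig A B => Sig (subst s A) (subst s1 B)
  | Pair a b => Pair (subst s a) (subst s b)
  | Split C t p => Split (subst s1 C) (subst s2 t) (subst s p)
  | Coprod A B => Coprod (subst s A) (subst s B)
  | Inl a => Inl (subst s a)
  | Inr b => Inr (subst s b)
  | Case C l r s' => Case (subst s1 C) (subst s1 l) (subst s1 r) (subst s s')
  | Unit => Unit
  | Tt => Tt
  | UnitInd C t u => UnitInd (subst s1 C) (subst s t) (subst s u)
  | Empty => Empty
  | EmptyInd C e => EmptyInd (subst s1 C) (subst s e)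
  | Nat => Nat
  | Zero => Zero
  | Succ n => Succ (subst s n)
  | NatInd C z t n => NatInd (subst s1 C) (subst s z) (subst s2 t) (subst s n)
  | Id A a b => Id (subst s A) (subst s a) (subst s b)
  | Refl a => Refl (subst s a)
  | J C c p => J (subst s2 C) (subst s c) (subst s p)
  | Trunc A => Trunc (subst s A)
  | TrIn a => TrIn (subst s a)
  | TrPath x y => TrPath (subst s x) (subst s y)
  | TrRec h f t => TrRec (subst s h) (subst s f) (subst s t)
  | Sk A => Sk (subst s A)
  | SkIn a => SkIn (subst s a)
  | SkLet C N M => SkLet (subst s1 C) (subst s1 N) (subst s M)
  | Csk A => Csk (subst s A)
  | CskIn a => CskIn (subst s a)
  | CskOut u => CskOut (subst s u)
  | Delta1 => Delta1
  | D0 => D0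
  | D1 => D1
  | Le x y => Le (subst s x) (subst s y)
  | Ax c => Ax c
  end.

(** [repl k a C] replaces index [0] of [C] by [a], a term in the remaining
    context extended by [k] further variables. *)
Definition repl (k : nat) (a C : term) : term :=
  subst (fun j => match j with 0 => a | S j => #(k + j) end) C.

Definition inst (C a : term) : term := repl 0 a C.

Definition inst2 (C a b : term) : term :=
  subst (fun j => match j with 0 => b | 1 => a | S (S j) => #j end) C.

(** ** Judgmental equality

    As in pure type systems, conversion is a relation on raw terms; the typing
    rule [T_conv] asks that its target be a type. *)

Reserved Notation "a ≡ b" (at level 70).

Inductive conv : term -> term -> Prop :=
| C_refl a : a ≡ a
| C_sym a b : a ≡ b -> b ≡ a
| C_trans a b c : a ≡ b -> b ≡ c -> a ≡ c
(* computation rules *)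
| C_beta A t a : App (Lam A t) a ≡ inst t a
| C_split C t a b : Split C t (Pair a b) ≡ inst2 t a b
| C_inl C l r a : Case C l r (Inl a) ≡ inst l a
| C_inr C l r b : Case C l r (Inr b) ≡ inst r b
| C_tt C t : UnitInd C t Tt ≡ t
| C_zero C z s : NatInd C z s Zero ≡ z
| C_succ C z s n : NatInd C z s (Succ n) ≡ inst2 s n (NatInd C z s n)
| C_J C c a : J C c (Refl a) ≡ c
| C_tr h f a : TrRec h f (TrIn a) ≡ App f a
| C_sk C N a : SkLet C N (SkIn a) ≡ inst N a
| C_csk a : CskOut (CskIn a) ≡ a
(* uniqueness rules *)
| C_eta A f : Lam A (App (f↑1) #0) ≡ f
| C_csk_eta u : CskIn (CskOut u) ≡ u
(* congruences *)
| C_Pi A A' B B' : A ≡ A' -> B ≡ B' -> Pi A B ≡ Pi A' B'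
| C_Lam A A' t t' : A ≡ A' -> t ≡ t' -> Lam A t ≡ Lam A' t'
| C_App f f' a a' : f ≡ f' -> a ≡ a' -> App f a ≡ App f' a'
| C_Sig A A' B B' : A ≡ A' -> B ≡ B' -> Sig A B ≡ Sig A' B'
| C_Pair a a' b b' : a ≡ a' -> b ≡ b' -> Pair a b ≡ Pair a' b'
| C_Split C C' t t' p p' :
    C ≡ C' -> t ≡ t' -> p ≡ p' -> Split C t p ≡ Split C' t' p'
| C_Coprod A A' B B' : A ≡ A' -> B ≡ B' -> Coprod A B ≡ Coprod A' B'
| C_Inl a a' : a ≡ a' -> Inl a ≡ Inl a'
| C_Inr b b' : b ≡ b' -> Inr b ≡ Inr b'
| C_Case C C' l l' r r' s s' :
    C ≡ C' -> l ≡ l' -> r ≡ r' -> s ≡ s' -> Case C l r s ≡ Case C' l' r' s'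
| C_UnitInd C C' t t' u u' :
    C ≡ C' -> t ≡ t' -> u ≡ u' -> UnitInd C t u ≡ UnitInd C' t' u'
| C_EmptyInd C C' e e' : C ≡ C' -> e ≡ e' -> EmptyInd C e ≡ EmptyInd C' e'
| C_Succ n n' : n ≡ n' -> Succ n ≡ Succ n'
| C_NatInd C C' z z' s s' n n' :
    C ≡ C' -> z ≡ z' -> s ≡ s' -> n ≡ n' -> NatInd C z s n ≡ NatInd C' z' s' n'
| C_Id A A' a a' b b' : A ≡ A' -> a ≡ a' -> b ≡ b' -> Id A a b ≡ Id A' a' b'
| C_Refl a a' : a ≡ a' -> Refl a ≡ Refl a'
| C_Jcong C C' c c' p p' : C ≡ C' -> c ≡ c' -> p ≡ p' -> J C c p ≡ J C' c' p'
| C_Trunc A A' : A ≡ A' -> Trunc A ≡ Trunc A'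
| C_TrIn a a' : a ≡ a' -> TrIn a ≡ TrIn a'
| C_TrPath x x' y y' : x ≡ x' -> y ≡ y' -> TrPath x y ≡ TrPath x' y'
| C_TrRec h h' f f' t t' :
    h ≡ h' -> f ≡ f' -> t ≡ t' -> TrRec h f t ≡ TrRec h' f' t'
| C_Sk A A' : A ≡ A' -> Sk A ≡ Sk A'
| C_SkIn a a' : a ≡ a' -> SkIn a ≡ SkIn a'
| C_SkLet C C' N N' M M' :
    C ≡ C' -> N ≡ N' -> M ≡ M' -> SkLet C N M ≡ SkLet C' N' M'
| C_Csk A A' : A ≡ A' -> Csk A ≡ Csk A'
| C_CskIn a a' : a ≡ a' -> CskIn a ≡ CskIn a'
| C_CskOut u u' : u ≡ u' -> CskOut u ≡ CskOut u'
| C_Le x x' y y' : x ≡ x' -> y ≡ y' -> Le x y ≡ Le x' y'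
where "a ≡ b" := (conv a b).

(** ** Derived notions

    Each of these takes terms in the ambient context, except that an argument
    [B] accompanying a domain [A] has one more variable, as in [Pi A B]. *)

Definition Arr (A B : term) : term := Pi A (B↑1).
Definition Prod (A B : term) : term := Sig A (B↑1).
Definition Iff (A B : term) : term := Prod (Arr A B) (Arr B A).
Definition Or (A B : term) : term := Trunc (Coprod A B).
Definition IsProp (A : term) : term := Pi A (Pi (A↑1) (Id (A↑2) #1 #0)).

Definition Fst (A p : term) : term := Split (A↑1) #1 p.
Definition Snd (A B p : term) : term := Split (repl 1 (Fst (A↑1) #0) B) #0 p.

Definition Fib (A B f b : term) : term := Sig A (Id (B↑1) (App (f↑1) #0) (b↑1)).

(** The pullback of [g : A -> C] and [h : B -> C]. *)
Definition Pullback (A B C g h : term) : term :=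
  Sig A (Sig (B↑1) (Id (C↑2) (App (g↑2) #1) (App (h↑2) #0))).

(** Bi-invertible maps. *)
Definition IsEquiv (A B f : term) : term :=
  Prod (Sig (Arr B A) (Pi (B↑1) (Id (B↑2) (App (f↑2) (App #1 #0)) #0)))
       (Sig (Arr B A) (Pi (A↑1) (Id (A↑2) (App #1 (App (f↑2) #0)) #0))).
Definition Equiv (A B : term) : term :=
  Sig (Arr A B) (IsEquiv (A↑1) (B↑1) #0).
Definition IdEquiv (A : term) : term :=
  let id := Lam A #0 in
  let inv := Pair id (Lam A (Refl #0)) in
  Pair id (Pair inv inv).

Definition Happly (A B f g : term) : term :=
  Lam (Id (Pi A B) f g)
    (J (Pi (A↑3) (Id (ren (up_ren (Nat.add 3)) B) (App (f↑4) #0) (App #2 #0)))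
       (Lam (A↑1) (Refl (App (f↑2) #0)))
       #0).
Definition IdToEquiv (i : nat) (A B : term) : term :=
  Lam (Id (Univ i) A B) (J (Equiv (A↑3) #1) (IdEquiv (A↑1)) #0).

(** [CrispPi j A B] is the product over a crisp variable [x :: A] of a family
    [B : Univ j], that is, the product over [v : sk A] of
    [let x^sk := v in B]. *)
Definition CrispPi (j : nat) (A B : term) : term :=
  Pi (Sk A) (SkLet (Univ j) (ren (up_ren S) B) #0).

Definition Counit (A : term) : term := Lam (Sk A) (SkLet (A↑2) #0 #0).
Definition IsSkeletal (A : term) : term := IsEquiv (Sk A) A (Counit A).

(** The functorial action of [sk] on a crisp [h : A -> B]. *)
Definition SkMap (A B h : term) : term :=
  Lam (Sk A) (SkLet (Sk (B↑2)) (SkIn (App (h↑2) #0)) #0).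

Definition IsCskModal (A : term) : term := IsEquiv A (Csk A) (Lam A (CskIn #0)).
Definition IsCskModalMap (A B f : term) : term :=
  Pi B (IsCskModal (Fib (A↑1) (B↑1) (f↑1) #0)).

Definition IsDelta1Null (X : term) : term :=
  IsEquiv X (Arr Delta1 X) (Lam X (Lam Delta1 #1)).

(** The [n]-fold power, with [Pow i A (Succ n)] computing to
    [Prod A (Pow i A n)]. *)
Definition Pow (i : nat) (A n : term) : term :=
  NatInd (Univ i) Unit (Prod (A↑2) #0) n.

(** [App (App (LeHead n) x) v] is [x <= v_1] for a vector [v] of length [n],
    or [Unit] when [n] is zero. *)
Definition LeHead (n : term) : term :=
  NatInd (Arr Delta1 (Arr (Pow 0 Delta1 #0) (Univ 0)))
    (Lam Delta1 (Lam Unit Unit))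
    (Lam Delta1 (Lam (Prod Delta1 (Pow 0 Delta1 #2)) (Le #1 (Fst Delta1 #0))))
    n.

Definition Sorted (n : term) : term :=
  NatInd (Arr (Pow 0 Delta1 #0) (Univ 0))
    (Lam Unit Unit)
    (let tail := Pow 0 Delta1 #2 in
     let x := Fst Delta1 #0 in
     let v := Snd Delta1 (tail↑1) #0 in
     Lam (Prod Delta1 (Pow 0 Delta1 #1))
       (Prod (App (App (LeHead #2) x) v) (App #1 v)))
    n.

Definition Delta (n : term) : term :=
  Sig (Pow 0 Delta1 n) (App (Sorted (n↑1)) #0).

(** For crisp [X], [Y], [f : X -> Y] and [n : Nat], the square
    [[
      sk (X^Delta[n]) -------> sk (X^(sk Delta[n]))
            |                          |
      sk (Y^Delta[n]) -------> sk (Y^(sk Delta[n]))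
    ]]
    is a pullback: its gap map is an equivalence.  The square commutes
    judgmentally on introduction forms. *)
Definition ContinuitySquareIsPullback (X Y f n : term) : term :=
  let D := Delta n in
  let XD := Arr D X in
  let XS := Arr (Sk D) X in
  let YD := Arr D Y in
  let YS := Arr (Sk D) Y in
  let restrict Z :=
    Lam (Arr D Z)
      (Lam ((Sk D)↑1) (App #1 (App ((Counit D)↑2) #0))) in
  let post E :=
    Lam (Arr E X) (Lam (E↑1) (App (f↑2) (App #1 #0))) in
  let top := SkMap XD XS (restrict X) in
  let bottom := SkMap YD YS (restrict Y) in
  let left := SkMap XD YD (post D) in
  let right := SkMap XS YS (post (Sk D)) in
  let homotopy :=
    SkLet
      (Id ((Sk YS)↑2) (App (right↑2) (App (top↑2) #0))
                      (App (bottom↑2) (App (left↑2) #0)))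
      (Refl (App (right↑2) (App (top↑2) (SkIn #0))))
      #0 in
  let gap :=
    Lam (Sk XD)
      (Pair (App (top↑1) #0) (Pair (App (left↑1) #0) homotopy)) in
  IsEquiv (Sk XD) (Pullback (Sk XS) (Sk YD) (Sk YS) right bottom) gap.

(** ** The axioms *)

Definition axiom_type (c : axiom) : term :=
  match c with
  | Funext i =>
      Pi (Univ i) (Pi (Arr #0 (Univ i))
        (Pi (Pi #1 (App #1 #0)) (Pi (Pi #2 (App #2 #0))
          (IsEquiv (Id (Pi #3 (App #3 #0)) #1 #0)
                   (Pi #3 (Id (App #3 #0) (App #2 #0) (App #1 #0)))
                   (Happly #3 (App #3 #0) #1 #0)))))
  | Univalence i =>
      Pi (Univ i) (Pi (Univ i)
        (IsEquiv (Id (Univ i) #1 #0) (Equiv #1 #0) (IdToEquiv i #1 #0)))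
  | LeProp => Pi Delta1 (Pi Delta1 (IsProp (Le #1 #0)))
  | LeRefl => Pi Delta1 (Le #0 #0)
  | LeTrans =>
      Pi Delta1 (Pi Delta1 (Pi Delta1
        (Arr (Le #2 #1) (Arr (Le #1 #0) (Le #2 #0)))))
  | LeAntisym =>
      Pi Delta1 (Pi Delta1
        (Arr (Le #1 #0) (Arr (Le #0 #1) (Id Delta1 #1 #0))))
  | LeTotal => Pi Delta1 (Pi Delta1 (Or (Le #1 #0) (Le #0 #1)))
  | LeLeast => Pi Delta1 (Le D0 #0)
  | LeGreatest => Pi Delta1 (Le #0 D1)
  | EndpointsDistinct => Arr (Id Delta1 D0 D1) Empty
  | SkeletalIffNull i =>
      CrispPi i (Univ i) (Iff (IsSkeletal #0) (IsDelta1Null #0))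
  | DetectContinuity i =>
      CrispPi (S i) (Univ i) (CrispPi i (Univ i) (CrispPi i (Arr #1 #0)
        (Iff (IsCskModalMap #2 #1 #0)
             (CrispPi i Nat (ContinuitySquareIsPullback #3 #2 #1 #0)))))
  | EndpointsCsk =>
      Pi Delta1 (Csk (Or (Id Delta1 #0 D0) (Id Delta1 #0 D1)))
  | CrispProjective i =>
      CrispPi (S i) Nat (CrispPi i (Arr (Delta #0) (Univ i))
        (Arr (Sk (Pi (Delta #1) (Trunc (App #1 #0))))
             (Trunc (Sk (Pi (Delta #1) (App #1 #0))))))
  end.

(** ** Contexts and typing

    A context is listed from the most recent variable.  Instead of splitting it
    into a crisp and an ordinary zone, every variable carries a mode; [Hidden]
    variables keep their index but may not be used.  Thus, where the dual-zone
    presentation of [Δ | Γ] passes to [Δ | ·], ordinary variables are hidden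
    ([lock]); where it passes to [Δ, Γ | ·], they become crisp ([promote]). *)

Inductive mode : Set := Crisp | Ordinary | Hidden.

Definition ctx : Set := list (mode * term).

Definition lock : ctx -> ctx :=
  map (fun '(m, A) => (match m with Crisp => Crisp | _ => Hidden end, A)).
Definition promote : ctx -> ctx :=
  map (fun '(m, A) => (match m with Hidden => Hidden | _ => Crisp end, A)).

Reserved Notation "G ⊢ a : A" (at level 80, a at level 75, A at level 75).

Notation "G ,, A" := ((Ordinary, A) :: G) (at level 72, left associativity).
Notation "G ,; A" := ((Crisp, A) :: G) (at level 72, left associativity).

(** The rules presuppose that the context is well formed, which [wf] makes
    explicit; premises on types of bound variables maintain this. *)
Inductive typing : ctx -> term -> term -> Prop :=
| T_var G k m A : nth_error G k = Some (m, A) -> m <> Hidden -> G ⊢ #k : A↑(S k)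
| T_conv G a A B i : G ⊢ a : A -> A ≡ B -> G ⊢ B : Univ i -> G ⊢ a : B
| T_univ G i : G ⊢ Univ i : Univ (S i)
| T_cumul G A i : G ⊢ A : Univ i -> G ⊢ A : Univ (S i)
| T_ax G c : G ⊢ Ax c : axiom_type c
(* dependent functions *)
| T_Pi G A B i : G ⊢ A : Univ i -> G,, A ⊢ B : Univ i -> G ⊢ Pi A B : Univ i
| T_Lam G A B t i : G ⊢ A : Univ i -> G,, A ⊢ t : B -> G ⊢ Lam A t : Pi A B
| T_App G A B f a : G ⊢ f : Pi A B -> G ⊢ a : A -> G ⊢ App f a : inst B a
(* dependent pairs *)
| T_Sig G A B i : G ⊢ A : Univ i -> G,, A ⊢ B : Univ i -> G ⊢ Sig A B : Univ i
| T_Pair G A B a b i :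
    G,, A ⊢ B : Univ i -> G ⊢ a : A -> G ⊢ b : inst B a -> G ⊢ Pair a b : Sig A B
| T_Split G A B C t p i :
    G,, Sig A B ⊢ C : Univ i ->
    G,, A,, B ⊢ t : repl 2 (Pair #1 #0) C ->
    G ⊢ p : Sig A B ->
    G ⊢ Split C t p : inst C p
(* coproducts *)
| T_Coprod G A B i : G ⊢ A : Univ i -> G ⊢ B : Univ i -> G ⊢ Coprod A B : Univ i
| T_Inl G A B a i : G ⊢ B : Univ i -> G ⊢ a : A -> G ⊢ Inl a : Coprod A B
| T_Inr G A B b i : G ⊢ A : Univ i -> G ⊢ b : B -> G ⊢ Inr b : Coprod A B
| T_Case G A B C l r s i :
    G,, Coprod A B ⊢ C : Univ i ->
    G,, A ⊢ l : repl 1 (Inl #0) C ->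
    G,, B ⊢ r : repl 1 (Inr #0) C ->
    G ⊢ s : Coprod A B ->
    G ⊢ Case C l r s : inst C s
(* unit and empty types *)
| T_Unit G i : G ⊢ Unit : Univ i
| T_Tt G : G ⊢ Tt : Unit
| T_UnitInd G C t u i :
    G,, Unit ⊢ C : Univ i -> G ⊢ t : inst C Tt -> G ⊢ u : Unit ->
    G ⊢ UnitInd C t u : inst C u
| T_Empty G i : G ⊢ Empty : Univ i
| T_EmptyInd G C e i :
    G,, Empty ⊢ C : Univ i -> G ⊢ e : Empty -> G ⊢ EmptyInd C e : inst C e
(* natural numbers *)
| T_Nat G i : G ⊢ Nat : Univ i
| T_Zero G : G ⊢ Zero : Nat
| T_Succ G n : G ⊢ n : Nat -> G ⊢ Succ n : Nat
| T_NatInd G C z s n i :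
    G,, Nat ⊢ C : Univ i ->
    G ⊢ z : inst C Zero ->
    G,, Nat,, C ⊢ s : repl 2 (Succ #1) C ->
    G ⊢ n : Nat ->
    G ⊢ NatInd C z s n : inst C n
(* identity types *)
| T_Id G A a b i :
    G ⊢ A : Univ i -> G ⊢ a : A -> G ⊢ b : A -> G ⊢ Id A a b : Univ i
| T_Refl G A a : G ⊢ a : A -> G ⊢ Refl a : Id A a a
| T_J G A a b C c p i :
    G,, A,, Id (A↑1) (a↑1) #0 ⊢ C : Univ i ->
    G ⊢ c : inst2 C a (Refl a) ->
    G ⊢ p : Id A a b ->
    G ⊢ J C c p : inst2 C b p
(* propositional truncation *)
| T_Trunc G A i : G ⊢ A : Univ i -> G ⊢ Trunc A : Univ i
| T_TrIn G A a : G ⊢ a : A -> G ⊢ TrIn a : Trunc A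
| T_TrPath G A x y :
    G ⊢ x : Trunc A -> G ⊢ y : Trunc A -> G ⊢ TrPath x y : Id (Trunc A) x y
| T_TrRec G A B h f t :
    G ⊢ h : IsProp B -> G ⊢ f : Arr A B -> G ⊢ t : Trunc A ->
    G ⊢ TrRec h f t : B
(* skeleton *)
| T_Sk G A i : lock G ⊢ A : Univ i -> G ⊢ Sk A : Univ i
| T_SkIn G A a : lock G ⊢ a : A -> G ⊢ SkIn a : Sk A
| T_SkLet G A C N M i j :
    lock G ⊢ A : Univ i ->
    G,, Sk A ⊢ C : Univ j ->
    G,; A ⊢ N : repl 1 (SkIn #0) C ->
    G ⊢ M : Sk A ->
    G ⊢ SkLet C N M : inst C M
(* coskeleton *)
| T_Csk G A i : promote G ⊢ A : Univ i -> G ⊢ Csk A : Univ i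
| T_CskIn G A a : promote G ⊢ a : A -> G ⊢ CskIn a : Csk A
| T_CskOut G A u : lock G ⊢ u : Csk A -> G ⊢ CskOut u : A
(* the interval and its order *)
| T_Delta1 G i : G ⊢ Delta1 : Univ i
| T_D0 G : G ⊢ D0 : Delta1
| T_D1 G : G ⊢ D1 : Delta1
| T_Le G x y i : G ⊢ x : Delta1 -> G ⊢ y : Delta1 -> G ⊢ Le x y : Univ i
where "G ⊢ a : A" := (typing G a A).

Inductive wf : ctx -> Prop :=
| wf_nil : wf []
| wf_ordinary G A i : wf G -> G ⊢ A : Univ i -> wf (G,, A)
| wf_crisp G A i : wf G -> lock G ⊢ A : Univ i -> wf (G,; A).

Definition inhabited_in (G : ctx) (A : term) : Prop := exists e, G ⊢ e : A.

(** ** Čech complexes *)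

Definition Cech (X Y f : term) : term :=
  Sig Y (Csk (Fib (X↑1) (Y↑1) (f↑1) #0)).

Definition CechSimplices (X Y f n : term) : term :=
  Sk (Arr (Delta n) (Cech X Y f)).

(** The pullback [X ×_Y ... ×_Y X] with [n + 1] factors, together with its map
    to [Y]: it is [(X, f)] for [n = 0], and the successor step forms the pullback
    of the previous map along [f]. *)
Definition IteratedPullbackOver (i : nat) (X Y f n : term) : term :=
  let P := Fst (Univ i) #0 in
  let p := Snd (Univ i) (Arr #0 (Y↑3)) #0 in
  let PX := Pullback P (X↑2) (Y↑2) p (f↑2) in
  NatInd (Sig (Univ i) (Arr #0 (Y↑2)))
    (Pair X f)
    (Pair PX (Lam PX (App (p↑1) (Fst (P↑1) #0))))
    n.

Definition IteratedPullback (i : nat) (X Y f n : term) : term :=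
  Fst (Univ i) (IteratedPullbackOver i X Y f n).

Definition FiberPowers (i : nat) (X Y f n : term) : term :=
  Sig Y (Pow i (Fib (X↑1) (Y↑1) (f↑1) #0) (Succ (n↑1))).

(** Crisp [X], [Y] with proofs that they are 0-skeletal, crisp [f : X -> Y] and
    crisp [n : Nat]; the variables are [X = #5], [Y = #4], [f = #1], [n = #0]. *)
Definition cech_context (i : nat) : ctx :=
  [] ,; Univ i
     ,; Univ i
     ,; IsSkeletal #1
     ,; IsSkeletal #1
     ,; Arr #3 #2
     ,; Nat.

Lemma T_eq G a A B : G ⊢ a : A -> A = B -> G ⊢ a : B.
Proof. now intros ? ->. Qed.

Ltac infer_type :=
  lazymatch goal with
  | |- _ ⊢ Pi _ _ : _ => eapply T_Pi; [check_type | check_type]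
  | |- _ ⊢ Sig _ _ : _ => eapply T_Sig; [check_type | check_type]
  | |- _ ⊢ Id _ _ _ : _ => eapply T_Id; [check_type | check_type | check_type]
  | |- _ ⊢ Sk _ : _ => eapply T_Sk; check_type
  | |- _ ⊢ Lam _ _ : _ => eapply T_Lam; [check_type | check_type]
  | |- _ ⊢ App _ _ : _ => eapply T_App; [infer_type | check_type]
  | |- _ ⊢ SkLet _ _ _ : _ =>
      eapply T_SkLet; cycle 3; [check_type | check_type | check_type | check_type]
  | |- _ ⊢ #_ : _ =>
      eapply T_eq; [eapply T_var; [reflexivity | discriminate] | cbv; reflexivity]
  end
with check_type := cbv; eapply T_eq; [infer_type | cbv; reflexivity].

Lemma cech_context_wf (i : nat) : wf (cech_context i).
Proof.
  apply wf_crisp with i; [|apply T_Nat].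
  do 3 (apply wf_crisp with i; [|cbn; check_type]).
  do 2 (apply wf_crisp with (S i); [|apply T_univ]).
  apply wf_nil.
Qed.

(* Main.v *)
(** Let [F y] be the fibre of [f] over [y]. By totality of the order the interval has
    binary meets, so every simplex is contracted along lines to its vertex 0, and a
    map from [Delta[n]] to the null type [Y] is constant. Maps from [Delta[n]] to the
    Čech complex are therefore pairs of [y : Y] and a map [Delta[n] -> csk (F y)].
    After applying [sk] these become maps [sk Delta[n] -> F y]; the two composites
    of this adjunction are judgmental identities up to the uniqueness rule of
    [csk]. Crisp induction on [n] shows that [sk Delta[n]] has [n + 1] points: a
    crisp element of [Delta[n + 1]] has first coordinate 0, and then lies in
    [Delta[n]], or 1, and then is the last vertex. Finally, the sum over [y] of
    [F y ^ (n + 1)] is null, hence 0-skeletal, and the outer [sk] can be dropped.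

    The derivations of the object theory are not written down: the argument is
    carried out in Rocq, its proof terms are read as raw terms, and a type
    checker, proved sound for the typing rules, accepts these by computation. *)

Require Import Defs.
From Stdlib Require Import List Arith Lia Bool.
Import ListNotations.

(** * Substitution *)

(** Two obstacles shape the proof. In the object theory, the rules for [sk] and [csk] apply to crisp
    data only. The adjunction is therefore used on total spaces under [sk], where the base point is
    crisp as well, whereas the count of points of [sk Delta[n]] allows any ordinary type [G] of
    values, so that it applies in the fibre over an ordinary [y]. Constancy of maps is taken with a
    witness that is trivial on constant maps: this coherence is used to exchange sums with
    functions, and to show that the path types of [Y], which occur in the fibres, are null. On the
    Rocq side, conversion relates raw terms, and no subject reduction is at hand. Only soundness of
    the checker is proved: a type exposed by reduction is checked again, and inversion is confined
    to type formers. As [i] is a variable, levels are coded by numerals, so that one computation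
    serves all [i]. Proved lemmas stay in the context as crisp variables, usable under [lock], until
    closed inhabitants are substituted for them. *)

Lemma ren_ext t : forall r r', (forall k, r k = r' k) -> ren r t = ren r' t.
Proof.
  assert (U : forall r r', (forall k, r k = r' k) ->
    forall k, up_ren r k = up_ren r' k) by (intros r r' H [|k]; cbn; auto).
  induction t; intros r r' H; cbn; f_equal; auto.
Qed.

Lemma up_ext s s' : (forall k, s k = s' k) -> forall k, up s k = up s' k.
Proof. intros H [|k]; cbn; rewrite ?H; reflexivity. Qed.

Lemma subst_ext t : forall s s', (forall k, s k = s' k) -> subst s t = subst s' t.
Proof.
  pose proof up_ext as U.
  induction t; intros s s' H; cbn; f_equal; auto 6.
Qed.

Lemma ren_as_subst t : forall r, ren r t = subst (fun k => #(r k)) t.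
Proof.
  assert (U1 : forall t r, subst (fun k => #(up_ren r k)) t = subst (up (fun k => #(r k))) t).
  { intros; apply subst_ext; intros [|k]; reflexivity. }
  assert (U2 : forall t r, subst (fun k => #(up_ren (up_ren r) k)) t
    = subst (up (up (fun k => #(r k)))) t).
  { intros; apply subst_ext; intros [|[|k]]; reflexivity. }
  induction t; intros r; cbn; f_equal; rewrite <- ?U2, <- ?U1; auto.
Qed.

Lemma subst_ren t : forall s r, subst s (ren r t) = subst (fun k => s (r k)) t.
Proof.
  assert (U1 : forall t s r, subst (fun k => up s (up_ren r k)) t = subst (up (fun k => s (r k))) t).
  { intros; apply subst_ext; intros [|k]; reflexivity. }
  assert (U2 : forall t s r, subst (fun k => up (up s) (up_ren (up_ren r) k)) t
    = subst (up (up (fun k => s (r k)))) t).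
  { intros; apply subst_ext; intros [|[|k]]; reflexivity. }
  induction t; intros s r; cbn; f_equal; rewrite <- ?(U2 _ s r), <- ?(U1 _ s r); auto.
Qed.

Lemma ren_ren t r r' : ren r (ren r' t) = ren (fun k => r (r' k)) t.
Proof. now rewrite (ren_as_subst _ r), subst_ren, <- ren_as_subst. Qed.

Lemma ren_up_wk r t : ren (up_ren r) t↑1 = (ren r t)↑1.
Proof. unfold wk. rewrite !ren_ren. now apply ren_ext. Qed.

Lemma ren_subst t : forall r s, ren r (subst s t) = subst (fun k => ren r (s k)) t.
Proof.
  assert (U0 : forall r s k, ren (up_ren r) (up s k) = up (fun k => ren r (s k)) k).
  { intros r s [|k]; cbn; rewrite ?ren_up_wk; reflexivity. }
  assert (U1 : forall t r s, subst (fun k => ren (up_ren r) (up s k)) t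
    = subst (up (fun k => ren r (s k))) t) by (intros; now apply subst_ext).
  assert (U2 : forall t r s, subst (fun k => ren (up_ren (up_ren r)) (up (up s) k)) t
    = subst (up (up (fun k => ren r (s k)))) t).
  { intros; apply subst_ext; intros k; rewrite U0; now apply up_ext. }
  induction t; intros r s; cbn; f_equal; rewrite <- ?(U2 _ r s), <- ?(U1 _ r s); auto.
Qed.

Lemma subst_up_wk s t : subst (up s) t↑1 = (subst s t)↑1.
Proof. unfold wk. rewrite subst_ren, ren_subst. now apply subst_ext. Qed.

Lemma subst_subst t : forall s s', subst s (subst s' t) = subst (fun k => subst s (s' k)) t.
Proof.
  assert (U0 : forall s s' k, subst (up s) (up s' k) = up (fun k => subst s (s' k)) k).
  { intros r s [|k]; cbn; rewrite ?subst_up_wk; reflexivity. }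
  assert (U1 : forall t s s', subst (fun k => subst (up s) (up s' k)) t
    = subst (up (fun k => subst s (s' k))) t) by (intros; now apply subst_ext).
  assert (U2 : forall t s s', subst (fun k => subst (up (up s)) (up (up s') k)) t
    = subst (up (up (fun k => subst s (s' k)))) t).
  { intros; apply subst_ext; intros k; rewrite U0; now apply up_ext. }
  induction t; intros s s'; cbn; f_equal; rewrite <- ?(U2 _ s s'), <- ?(U1 _ s s'); auto.
Qed.

Lemma subst_id t : forall s, (forall k, s k = #k) -> subst s t = t.
Proof.
  assert (U : forall s, (forall k, s k = #k) -> forall k, up s k = #k).
  { intros s H [|k]; cbn; rewrite ?H; reflexivity. }
  induction t; intros s H; cbn; f_equal; auto 6.
Qed.

Ltac subst_eq :=
  intros; unfold inst, inst2, repl, wk;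
  rewrite ?ren_ren, ?ren_subst, ?subst_ren, ?subst_subst, ?ren_as_subst, ?subst_subst;
  try apply subst_ext; 
  try (intros k; destruct k as [|[|k]]; cbn;
  unfold wk; rewrite ?ren_ren, ?ren_subst, ?subst_ren, ?subst_subst, ?ren_as_subst, ?subst_subst; cbn;
  try reflexivity; try (apply subst_ext; intros; cbn; reflexivity); try (symmetry; now apply subst_id)).

Lemma subst_inst s B a : subst s (inst B a) = inst (subst (up s) B) (subst s a).
Proof. subst_eq. Qed.

Lemma subst_inst2 s C a b :
  subst s (inst2 C a b) = inst2 (subst (up (up s)) C) (subst s a) (subst s b).
Proof. subst_eq. Qed.

Lemma subst_repl1 s a C :
  subst (up s) (repl 1 a C) = repl 1 (subst (up s) a) (subst (up s) C).
Proof. subst_eq. Qed.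

Lemma subst_repl2 s a C :
  subst (up (up s)) (repl 2 a C) = repl 2 (subst (up (up s)) a) (subst (up s) C).
Proof. subst_eq. Qed.

Lemma inst_wk A a : inst A↑1 a = A.
Proof. unfold inst, repl, wk. rewrite subst_ren. now apply subst_id. Qed.

Lemma conv_subst a b : a ≡ b -> forall s, subst s a ≡ subst s b.
Proof.
  induction 1; intros sg; cbn;
    rewrite ?subst_inst, ?subst_inst2, ?subst_up_wk; try (constructor; now auto).
  eapply C_trans; eauto.
Qed.

Lemma wk_S n t : t↑(S n) = (t↑n)↑1.
Proof. unfold wk. now rewrite ren_ren. Qed.

Lemma subst_IsProp s A : subst s (IsProp A) = IsProp (subst s A).
Proof.
  unfold IsProp; cbn. rewrite subst_up_wk, !(wk_S 1), !subst_up_wk. reflexivity.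
Qed.

(** * Stability of typing under renaming and substitution *)

Section Substitution.

  Variable ok : (nat -> term) -> ctx -> ctx -> Prop.
  Hypothesis ok_var : forall s D G k m A, ok s D G ->
    nth_error D k = Some (m, A) -> m <> Hidden -> G ⊢ s k : subst s A↑(S k).
  Hypothesis ok_up : forall s D G m A, ok s D G ->
    ok (up s) ((m, A) :: D) ((m, subst s A) :: G).
  Hypothesis ok_lock : forall s D G, ok s D G -> ok s (lock D) (lock G).
  Hypothesis ok_promote : forall s D G, ok s D G -> ok s (promote D) (promote G).

  (** Weakening must be known before substitution can pass under binders, so the induction is done
      once, for an abstract relation [ok], and instantiated twice. The rules change contexts only by
      extension, [lock] and [promote], whence the closure hypotheses. *)
  Lemma typing_ok D t A : D ⊢ t : A -> forall s G, ok s D G -> G ⊢ subst s t : subst s A.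
  Proof.
    induction 1; intros s' G0 Hok; cbn [subst];
      rewrite ?subst_inst, ?subst_inst2.
    - eauto.
    - cbn in *. eapply T_conv; [now eauto | now apply conv_subst | now eauto].
    - apply T_univ.
    - apply T_cumul; eauto.
    - eapply T_eq; [apply T_ax|]. destruct c; reflexivity.
    - apply T_Pi; eauto.
    - eapply T_Lam; eauto.
    - eapply T_App; [now apply IHtyping1 | now apply IHtyping2].
    - apply T_Sig; eauto.
    - eapply T_Pair; [now eauto | now eauto |]. rewrite <- subst_inst. now eauto.
    - eapply T_Split with (A := subst s' A) (B := subst (up s') B);
        [exact (IHtyping1 _ _ (ok_up _ _ _ Ordinary (Sig A B) Hok)) | | now apply IHtyping3].
      eapply T_eq; [now eapply IHtyping2; do 2 apply ok_up|].
      now rewrite subst_repl2.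
    - apply T_Coprod; eauto.
    - eapply T_Inl; eauto.
    - eapply T_Inr; eauto.
    - eapply T_Case with (A := subst s' A) (B := subst s' B);
        [exact (IHtyping1 _ _ (ok_up _ _ _ Ordinary (Coprod A B) Hok)) | | | now apply IHtyping4].
      + eapply T_eq; [now eapply IHtyping2; apply ok_up|]. now rewrite subst_repl1.
      + eapply T_eq; [now eapply IHtyping3; apply ok_up|]. now rewrite subst_repl1.
    - apply T_Unit.
    - apply T_Tt.
    - eapply T_UnitInd; [exact (IHtyping1 _ _ (ok_up _ _ _ Ordinary Unit Hok)) | | now apply IHtyping3].
      eapply T_eq; [now apply IHtyping2 | apply subst_inst].
    - apply T_Empty.
    - eapply T_EmptyInd; [exact (IHtyping1 _ _ (ok_up _ _ _ Ordinary Empty Hok)) | now apply IHtyping2].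
    - apply T_Nat.
    - apply T_Zero.
    - apply T_Succ; eauto.
    - eapply T_NatInd; [exact (IHtyping1 _ _ (ok_up _ _ _ Ordinary Nat Hok)) | | | now apply IHtyping4].
      + eapply T_eq; [now apply IHtyping2 | apply subst_inst].
      + eapply T_eq; [exact (IHtyping3 _ _ (ok_up _ _ _ Ordinary C (ok_up _ _ _ Ordinary Nat Hok)))|].
        now rewrite subst_repl2.
    - apply T_Id; eauto.
    - apply T_Refl; eauto.
    - eapply T_J; [| | now apply IHtyping3].
      + eapply IHtyping1.
        specialize (ok_up _ _ _ Ordinary (Id A↑1 a↑1 #0) (ok_up _ _ _ Ordinary A Hok)).
        cbn in ok_up. now rewrite !subst_up_wk in ok_up.
      + eapply T_eq; [now apply IHtyping2 | apply subst_inst2].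
    - apply T_Trunc; eauto.
    - apply T_TrIn; eauto.
    - apply T_TrPath; eauto.
    - eapply T_TrRec with (A := subst s' A); [ | | now apply IHtyping3].
      + eapply T_eq; [now apply IHtyping1 | apply subst_IsProp].
      + eapply T_eq; [now apply IHtyping2|].
        unfold Arr. cbn. now rewrite subst_up_wk.
    - apply T_Sk; eauto.
    - apply T_SkIn; eauto.
    - eapply T_SkLet with (A := subst s' A); [now eauto | | | now apply IHtyping4].
      + exact (IHtyping2 _ _ (ok_up _ _ _ Ordinary (Sk A) Hok)).
      + eapply T_eq; [exact (IHtyping3 _ _ (ok_up _ _ _ Crisp A Hok))|]. now rewrite subst_repl1.
    - apply T_Csk; eauto.
    - apply T_CskIn; eauto.
    - apply T_CskOut; eauto.
    - apply T_Delta1.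
    - apply T_D0.
    - apply T_D1.
    - apply T_Le; eauto.
  Qed.

End Substitution.

Definition mode_le (m m' : mode) : Prop :=
  match m, m' with
  | Hidden, _ | _, Crisp | Ordinary, Ordinary => True
  | _, _ => False
  end.

Lemma nth_lock G k m A : nth_error (lock G) k = Some (m, A) -> m <> Hidden ->
  m = Crisp /\ nth_error G k = Some (Crisp, A).
Proof.
  unfold lock. rewrite nth_error_map.
  destruct (nth_error G k) as [[[] B]|]; cbn; intros [= <- <-]; intuition congruence.
Qed.

Lemma nth_promote G k m A : nth_error (promote G) k = Some (m, A) -> m <> Hidden ->
  m = Crisp /\ exists m', nth_error G k = Some (m', A) /\ m' <> Hidden.
Proof.
  unfold promote. rewrite nth_error_map.
  destruct (nth_error G k) as [[[] B]|]; cbn; intros [= <- <-];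
    intuition (eauto; congruence || (eexists; split; [reflexivity|congruence])).
Qed.

Lemma nth_lock_crisp G k A :
  nth_error G k = Some (Crisp, A) -> nth_error (lock G) k = Some (Crisp, A).
Proof. unfold lock. rewrite nth_error_map. now intros ->. Qed.

Lemma nth_promote_crisp G k m A : m <> Hidden ->
  nth_error G k = Some (m, A) -> nth_error (promote G) k = Some (Crisp, A).
Proof. unfold promote. rewrite nth_error_map. intros ? ->. now destruct m. Qed.

Lemma lock_lock G : lock (lock G) = lock G.
Proof. unfold lock. rewrite map_map. apply map_ext. now intros [[] A]. Qed.

Lemma promote_lock G : promote (lock G) = lock G.
Proof. unfold promote, lock. rewrite map_map. apply map_ext. now intros [[] A]. Qed.

Lemma lock_promote G : lock (promote G) = promote G.
Proof. unfold promote, lock. rewrite map_map. apply map_ext. now intros [[] A]. Qed.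

(** Variables may become more available, with [Hidden] below [Ordinary] below [Crisp]. The identity
    renaming then also gives the passages from [lock G] to [G] and from [G] to [promote G]. *)
Definition renaming (s : nat -> term) (D G : ctx) : Prop :=
  exists r, (forall k, s k = #(r k)) /\
  forall k m A, nth_error D k = Some (m, A) -> m <> Hidden ->
  exists m' A', nth_error G (r k) = Some (m', A') /\ mode_le m m' /\
    A'↑(S (r k)) = ren r A↑(S k).

Lemma typing_renaming D t A s G : D ⊢ t : A -> renaming s D G -> G ⊢ subst s t : subst s A.
Proof.
  intros H; revert s G; refine (typing_ok renaming _ _ _ _ D t A H).
  - intros s D' G k m B (r & Hs & Hr) Hk Hm.
    destruct (Hr _ _ _ Hk Hm) as (m' & B' & Hk' & Hle & E).
    rewrite (subst_ext _ s (fun k => #(r k)) Hs), <- ren_as_subst, <- E, Hs.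
    eapply T_var; [eassumption|]. now destruct m, m'.
  - intros s D' G m B (r & Hs & Hr). exists (up_ren r); split.
    + intros [|k]; cbn; rewrite ?Hs; reflexivity.
    + intros [|k] m' C; cbn.
      * intros [= <- <-] Hm. exists m, (subst s B). repeat split.
        -- now destruct m.
        -- change (ren S) with (wk 1).
           rewrite ren_up_wk, ren_as_subst. f_equal; now apply subst_ext.
      * intros Hk Hm. destruct (Hr _ _ _ Hk Hm) as (m1 & B' & Hk' & Hle & E).
        exists m1, B'; repeat split; auto.
        now rewrite wk_S, E, (wk_S (S k)), ren_up_wk.
  - intros s D' G (r & Hs & Hr). exists r; split; [assumption|].
    intros k m B Hk Hm. destruct (nth_lock _ _ _ _ Hk Hm) as [-> Hk'].
    destruct (Hr _ _ _ Hk' Hm) as ([] & B' & ? & [] & ?).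
    exists Crisp, B'. repeat split; [now apply nth_lock_crisp | assumption].
  - intros s D' G (r & Hs & Hr). exists r; split; [assumption|].
    intros k m B Hk Hm. destruct (nth_promote _ _ _ _ Hk Hm) as [-> (m' & Hk' & Hm')].
    destruct (Hr _ _ _ Hk' Hm') as (m1 & B' & ? & ? & ?).
    exists Crisp, B'. repeat split; [|assumption].
    eapply nth_promote_crisp; [|eassumption]. now destruct m', m1.
Qed.

Lemma renaming_id D G :
  (forall k m A, nth_error D k = Some (m, A) -> m <> Hidden ->
    exists m', nth_error G k = Some (m', A) /\ mode_le m m') ->
  renaming Var D G.
Proof.
  intros H; exists (fun k => k); split; [reflexivity|].
  intros k m A Hk Hm. destruct (H _ _ _ Hk Hm) as (m' & ? & ?).
  exists m', A. repeat split; auto. rewrite ren_as_subst. symmetry. now apply subst_id.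
Qed.

Lemma typing_id D G t A : D ⊢ t : A ->
  (forall k m A, nth_error D k = Some (m, A) -> m <> Hidden ->
    exists m', nth_error G k = Some (m', A) /\ mode_le m m') ->
  G ⊢ t : A.
Proof.
  intros H R. apply renaming_id in R. pose proof (typing_renaming _ _ _ _ _ H R) as T.
  now rewrite !subst_id in T.
Qed.

Lemma typing_unlock G t A : lock G ⊢ t : A -> G ⊢ t : A.
Proof.
  intros H; apply (typing_id _ _ _ _ H). intros k m B Hk Hm.
  destruct (nth_lock _ _ _ _ Hk Hm) as [-> Hk']. now exists Crisp.
Qed.

Lemma typing_promote G t A : G ⊢ t : A -> promote G ⊢ t : A.
Proof.
  intros H; apply (typing_id _ _ _ _ H). intros k m B Hk Hm.
  exists Crisp; split; [eapply nth_promote_crisp; eauto | now destruct m].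
Qed.

Lemma typing_app_ctx G H t A : G ⊢ t : A -> G ++ H ⊢ t : A.
Proof.
  intros T; apply (typing_id _ _ _ _ T). intros k m B Hk Hm.
  exists m; split; [|now destruct m].
  rewrite nth_error_app1; [assumption|]. apply nth_error_Some. congruence.
Qed.

Lemma typing_wk G mB t A : G ⊢ t : A -> mB :: G ⊢ t↑1 : A↑1.
Proof.
  intros H. unfold wk. rewrite !ren_as_subst. eapply typing_renaming; [eassumption|].
  exists S; split; [reflexivity|]. intros k m B Hk Hm. exists m, B. repeat split.
  - assumption.
  - now destruct m.
  - now rewrite (wk_S (S k)).
Qed.

Definition substitution (s : nat -> term) (D G : ctx) : Prop :=
  forall k m A, nth_error D k = Some (m, A) ->
  match m with
  | Crisp => lock G ⊢ s k : subst s A↑(S k)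
  | Ordinary => G ⊢ s k : subst s A↑(S k)
  | Hidden => True
  end.

Lemma substitution_up s D G m A : substitution s D G ->
  substitution (up s) ((m, A) :: D) ((m, subst s A) :: G).
Proof.
  intros Hs [|k] m' B; cbn [nth_error up].
  - intros [= <- <-]. rewrite subst_up_wk. destruct m; [| |exact I].
    + now eapply T_var with (k := 0).
    + now eapply T_var with (k := 0).
  - intros Hk. specialize (Hs _ _ _ Hk). rewrite (wk_S (S k)), subst_up_wk.
    destruct m'; [| |exact I]; now apply typing_wk.
Qed.

Lemma typing_substitution D t A s G :
  D ⊢ t : A -> substitution s D G -> G ⊢ subst s t : subst s A.
Proof.
  intros H; revert s G; refine (typing_ok substitution _ _ _ _ D t A H).
  - intros s D' G k m B Hs Hk Hm. specialize (Hs _ _ _ Hk).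
    destruct m; [now apply typing_unlock | assumption | congruence].
  - intros; now apply substitution_up.
  - intros s D' G Hs k m B Hk. destruct m; [| |exact I].
    + destruct (nth_lock _ _ _ _ Hk) as [_ Hk']; [congruence|].
      rewrite lock_lock. exact (Hs _ _ _ Hk').
    + destruct (nth_lock _ _ _ _ Hk) as [? _]; congruence.
  - intros s D' G Hs k m B Hk. destruct m; [| |exact I].
    + destruct (nth_promote _ _ _ _ Hk) as [_ (m' & Hk' & Hm')]; [congruence|].
      (* A variable made crisp by [promote] has to receive a term over [lock (promote G)], which is
         [promote G] itself. *)
      rewrite lock_promote. specialize (Hs _ _ _ Hk'). destruct m'; [| |congruence].
      * now apply typing_promote, typing_unlock.
      * now apply typing_promote.
    + destruct (nth_promote _ _ _ _ Hk) as [? _]; congruence.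
Qed.

Lemma wk_subst_cons A a k s : subst (fun j => match j with 0 => a | S j => s j end) A↑(S k)
  = subst s A↑k.
Proof. unfold wk. rewrite !subst_ren. now apply subst_ext. Qed.

Lemma substitution_cons G (m : mode) A a B s D : substitution s D G ->
  match m with Crisp => lock G ⊢ a : B | Ordinary => G ⊢ a : B | Hidden => True end ->
  B = subst s A ->
  substitution (fun j => match j with 0 => a | S j => s j end) ((m, A) :: D) G.
Proof.
  intros Hs Ha -> [|k] m' C; cbn [nth_error].
  - intros [= <- <-]. rewrite wk_subst_cons.
    replace (subst s A↑0) with (subst s A); [assumption|]. unfold wk.
    rewrite subst_ren. now apply subst_ext.
  - intros Hk. rewrite wk_subst_cons. exact (Hs _ _ _ Hk).
Qed.

Lemma substitution_var G : substitution Var G G.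
Proof.
  intros k m A Hk. rewrite subst_id by reflexivity. destruct m; [| |exact I].
  - eapply T_var; [now apply nth_lock_crisp | congruence].
  - eapply T_var; [eassumption | congruence].
Qed.

Lemma substitution_inst G A a : G ⊢ a : A ->
  substitution (fun j => match j with 0 => a | S j => #(0 + j) end) (G,, A) G.
Proof.
  intros. eapply substitution_cons with (m := Ordinary) (s := Var);
    [apply substitution_var | eassumption | now rewrite subst_id].
Qed.

Lemma typing_inst G A t B a : G,, A ⊢ t : B -> G ⊢ a : A -> G ⊢ inst t a : inst B a.
Proof. intros. eapply typing_substitution; [eassumption | now apply substitution_inst]. Qed.

(** * A type checker *)

(** The checker compares levels, so the level [i] cannot occur in its input as a
    variable. There, an even number [2 * k] stands for the level [k] and an odd
    number [2 * k + 1] for the level [k + i]. *)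
Definition level (i k : nat) : nat := if Nat.even k then k / 2 else k / 2 + i.

Definition level_le (a b : nat) : bool := (a <=? b) && (Nat.even a || Nat.odd b).

(** Two codes are incomparable only if an odd one is below an even one. The successor of the even
    one is then odd and bounds both, whatever [i] is. *)
Definition level_max (a b : nat) : nat :=
  if level_le a b then b else if level_le b a then a else S (Nat.max a b).

Lemma level_le_sound i a b : level_le a b = true -> level i a <= level i b.
Proof.
  unfold level_le, level. intros [H1%Nat.leb_le H2]%andb_prop.
  pose proof (Nat.Div0.div_le_mono _ _ 2 H1) as H3.
  rewrite <- Nat.negb_even in H2. destruct (Nat.even a), (Nat.even b); cbn in H2; lia || discriminate.
Qed.

Lemma level_SS i k : level i (S (S k)) = S (level i k).
Proof.
  unfold level. cbn [Nat.even]. replace (S (S k)) with (k + 1 * 2) by lia.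
  rewrite Nat.div_add by discriminate. destruct (Nat.even k); lia.
Qed.

Lemma level_max_l i a b : level i a <= level i (level_max a b).
Proof.
  unfold level_max. destruct (level_le a b) eqn:E; [now apply level_le_sound|].
  destruct (level_le b a) eqn:F; [lia|]. apply level_le_sound.
  revert E F. unfold level_le.
  rewrite Nat.odd_succ, <- !Nat.negb_even. 
  destruct (Nat.leb_spec a b), (Nat.leb_spec b a), (Nat.leb_spec a (S (Nat.max a b))),
   (Nat.even a) eqn:A, (Nat.even b) eqn:B; cbn; try discriminate; try lia; try reflexivity;
  destruct (Nat.max_spec a b) as [[? ->]|[? ->]]; rewrite ?A, ?B; reflexivity || lia.
Qed.

Lemma level_max_r i a b : level i b <= level i (level_max a b).
Proof.
  unfold level_max. destruct (level_le a b) eqn:E; [lia|].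
  destruct (level_le b a) eqn:F; [now apply level_le_sound|]. apply level_le_sound.
  revert E F. unfold level_le.
  rewrite Nat.odd_succ, <- !Nat.negb_even. 
  destruct (Nat.leb_spec a b), (Nat.leb_spec b a), (Nat.leb_spec b (S (Nat.max a b))),
   (Nat.even a) eqn:A, (Nat.even b) eqn:B; cbn; try discriminate; try lia; try reflexivity;
  destruct (Nat.max_spec a b) as [[? ->]|[? ->]]; rewrite ?A, ?B; reflexivity || lia.
Qed.

Definition decode_axiom (i : nat) (c : axiom) : axiom :=
  match c with
  | Funext k => Funext (level i k)
  | Univalence k => Univalence (level i k)
  | SkeletalIffNull k => SkeletalIffNull (level i k)
  | DetectContinuity k => DetectContinuity (level i k)
  | CrispProjective k => CrispProjective (level i k)
  | _ => c
  end.

Fixpoint decode (i : nat) (t : term) : term :=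
  let d := decode i in
  match t with
  | Var k => Var k
  | Univ l => Univ (level i l)
  | Pi A B => Pi (d A) (d B)
  | Lam A t => Lam (d A) (d t)
  | App f a => App (d f) (d a)
  | Sig A B => Sig (d A) (d B)
  | Pair a b => Pair (d a) (d b)
  | Split C t p => Split (d C) (d t) (d p)
  | Coprod A B => Coprod (d A) (d B)
  | Inl a => Inl (d a)
  | Inr b => Inr (d b)
  | Case C l r s => Case (d C) (d l) (d r) (d s)
  | Unit => Unit
  | Tt => Tt
  | UnitInd C t u => UnitInd (d C) (d t) (d u)
  | Empty => Empty
  | EmptyInd C e => EmptyInd (d C) (d e)
  | Nat => Nat
  | Zero => Zero
  | Succ n => Succ (d n)
  | NatInd C z s n => NatInd (d C) (d z) (d s) (d n)
  | Id A a b => Id (d A) (d a) (d b)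
  | Refl a => Refl (d a)
  | J C c p => J (d C) (d c) (d p)
  | Trunc A => Trunc (d A)
  | TrIn a => TrIn (d a)
  | TrPath x y => TrPath (d x) (d y)
  | TrRec h f t => TrRec (d h) (d f) (d t)
  | Sk A => Sk (d A)
  | SkIn a => SkIn (d a)
  | SkLet C N M => SkLet (d C) (d N) (d M)
  | Csk A => Csk (d A)
  | CskIn a => CskIn (d a)
  | CskOut u => CskOut (d u)
  | Delta1 => Delta1
  | D0 => D0
  | D1 => D1
  | Le x y => Le (d x) (d y)
  | Ax c => Ax (decode_axiom i c)
  end.

Definition decode_ctx (i : nat) : ctx -> ctx := map (fun '(m, A) => (m, decode i A)).

Lemma decode_ren i t : forall r, decode i (ren r t) = ren r (decode i t).
Proof. induction t; intros; cbn; f_equal; auto. Qed.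

Lemma decode_wk i n t : decode i t↑n = (decode i t)↑n.
Proof. apply decode_ren. Qed.

Lemma decode_subst i t : forall s,
  decode i (subst s t) = subst (fun k => decode i (s k)) (decode i t).
Proof.
  assert (U0 : forall s k, decode i (up s k) = up (fun k => decode i (s k)) k).
  { intros s [|k]; cbn; rewrite ?decode_wk; reflexivity. }
  assert (U1 : forall t s, subst (fun k => decode i (up s k)) t
    = subst (up (fun k => decode i (s k))) t) by (intros; now apply subst_ext).
  assert (U2 : forall t s, subst (fun k => decode i (up (up s) k)) t
    = subst (up (up (fun k => decode i (s k)))) t).
  { intros; apply subst_ext; intros k; rewrite U0; now apply up_ext. }
  induction t; intros s; cbn; f_equal; rewrite <- ?(U2 _ s), <- ?(U1 _ s); auto.
Qed.

Lemma decode_inst i B a : decode i (inst B a) = inst (decode i B) (decode i a).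
Proof. unfold inst, repl. rewrite decode_subst. apply subst_ext. now intros [|k]. Qed.

Lemma decode_repl i k a B : decode i (repl k a B) = repl k (decode i a) (decode i B).
Proof. unfold repl. rewrite decode_subst. apply subst_ext. now intros [|j]. Qed.

Lemma decode_inst2 i C a b :
  decode i (inst2 C a b) = inst2 (decode i C) (decode i a) (decode i b).
Proof. unfold inst2. rewrite decode_subst. apply subst_ext. now intros [|[|k]]. Qed.

Lemma conv_decode i a b : a ≡ b -> decode i a ≡ decode i b.
Proof.
  induction 1; cbn; rewrite ?decode_inst, ?decode_inst2, ?decode_wk;
    try (constructor; assumption).
  eapply C_trans; eassumption.
Qed.

Ltac conv_congr := first
  [ apply C_Pi | apply C_Lam | apply C_App | apply C_Sig | apply C_Pair | apply C_Split
  | apply C_Coprod | apply C_Inl | apply C_Inr | apply C_Case | apply C_UnitInd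
  | apply C_EmptyInd | apply C_Succ | apply C_NatInd | apply C_Id | apply C_Refl
  | apply C_Jcong | apply C_Trunc | apply C_TrIn | apply C_TrPath | apply C_TrRec
  | apply C_Sk | apply C_SkIn | apply C_SkLet | apply C_Csk | apply C_CskIn
  | apply C_CskOut | apply C_Le | apply C_refl ].

Lemma conv_up s s' : (forall k, s k ≡ s' k) -> forall k, up s k ≡ up s' k.
Proof.
  intros H [|k]; cbn; [apply C_refl|]. unfold wk.
  rewrite !ren_as_subst. now apply conv_subst.
Qed.

Lemma conv_subst_pointwise t : forall s s', (forall k, s k ≡ s' k) -> subst s t ≡ subst s' t.
Proof.
  pose proof conv_up.
  induction t; intros s s' Hs; cbn; auto; conv_congr; auto 6.
Qed.

(** * Weak head reduction and a conversion test *)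

Fixpoint whnf (n : nat) (t : term) : term :=
  match n with
  | 0 => t
  | S n =>
    match t with
    | App f a =>
        match whnf n f with Lam _ b => whnf n (inst b a) | f' => App f' a end
    | Split C b p =>
        match whnf n p with Pair x y => whnf n (inst2 b x y) | p' => Split C b p' end
    | Case C l r s =>
        match whnf n s with
        | Inl a => whnf n (inst l a)
        | Inr b => whnf n (inst r b)
        | s' => Case C l r s'
        end
    | UnitInd C b u => match whnf n u with Tt => whnf n b | u' => UnitInd C b u' end
    | NatInd C z s m =>
        match whnf n m with
        | Zero => whnf n z
        | Succ k => whnf n (inst2 s k (NatInd C z s k))
        | m' => NatInd C z s m'
        end
    | J C c p => match whnf n p with Refl _ => whnf n c | p' => J C c p' end
    | TrRec h f u => match whnf n u with TrIn a => whnf n (App f a) | u' => TrRec h f u' end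
    | SkLet C N M =>
        match whnf n M with SkIn a => whnf n (inst N a) | M' => SkLet C N M' end
    | CskOut u => match whnf n u with CskIn a => whnf n a | u' => CskOut u' end
    | _ => t
    end
  end.


Lemma whnf_conv n : forall t, t ≡ whnf n t.
Proof.
  induction n as [|n IH]; intros t; [apply C_refl|].
  destruct t; cbn; try apply C_refl;
    match goal with |- _ ≡ match whnf n ?u with _ => _ end =>
      pose proof (IH u) as Hu; destruct (whnf n u) end;
    try (conv_congr; (exact Hu || apply C_refl); fail);
    (eapply C_trans; [|apply IH]);
    (eapply C_trans; [conv_congr; (exact Hu || apply C_refl)|]);
    first [apply C_beta | apply C_split | apply C_inl | apply C_inr | apply C_tt | apply C_zero
      | apply C_succ | apply C_J | apply C_tr | apply C_sk | apply C_csk].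
Qed.

Scheme Equality for axiom.
Scheme Equality for term.

(** Comparison ignores the domains of abstractions: those are irrelevant up to
    [≡], by the rules [C_beta] and [C_eta]. *)
Fixpoint convertible (n : nat) (a b : term) : bool :=
  match n with
  | 0 => false
  | S n =>
    let cv := convertible n in
    term_beq a b ||
    let a := whnf n a in
    let b := whnf n b in
    term_beq a b ||
    match a, b with
    | Pi A B, Pi A' B' | Sig A B, Sig A' B' | Coprod A B, Coprod A' B' => cv A A' && cv B B'
    | Lam _ t, Lam _ t' => cv t t'
    | Lam _ t, u => cv t (App u↑1 #0)
    | u, Lam _ t => cv (App u↑1 #0) t
    | App f a, App f' a' => cv f f' && cv a a'
    | Pair a b, Pair a' b' => cv a a' && cv b b'
    | Split C t p, Split C' t' p' => cv p p' && cv C C' && cv t t'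
    | Inl a, Inl a' | Inr a, Inr a' | Succ a, Succ a' | Refl a, Refl a'
    | Trunc a, Trunc a' | TrIn a, TrIn a' | Sk a, Sk a' | SkIn a, SkIn a'
    | Csk a, Csk a' | CskIn a, CskIn a' | CskOut a, CskOut a' => cv a a'
    | CskIn a, u => cv a (CskOut u)
    | u, CskIn a => cv (CskOut u) a
    | Case C l r s, Case C' l' r' s' => cv s s' && cv C C' && cv l l' && cv r r'
    | UnitInd C t u, UnitInd C' t' u' => cv u u' && cv C C' && cv t t'
    | EmptyInd C e, EmptyInd C' e' => cv e e' && cv C C'
    | NatInd C z s m, NatInd C' z' s' m' => cv m m' && cv C C' && cv z z' && cv s s'
    | Id A a b, Id A' a' b' => cv A A' && cv a a' && cv b b'
    | J C c p, J C' c' p' => cv p p' && cv C C' && cv c c'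
    | TrPath x y, TrPath x' y' => cv x x' && cv y y'
    | TrRec h f t, TrRec h' f' t' => cv t t' && cv h h' && cv f f'
    | SkLet C N M, SkLet C' N' M' => cv M M' && cv C C' && cv N N'
    | Le x y, Le x' y' => cv x x' && cv y y'
    | _, _ => false
    end
  end.

(** Expanding [Lam A t] by [C_eta] with the domain [A'] gives an abstraction over [A'] whose body is
    a beta-redex that contracts to [t]. *)
Lemma conv_Lam A A' t : Lam A t ≡ Lam A' t.
Proof.
  eapply C_trans; [apply C_sym, (C_eta A')|]. apply C_Lam; [apply C_refl|].
  cbn. eapply C_trans; [apply C_beta|].
  replace (inst _ _) with t; [apply C_refl|].
  unfold inst, repl. rewrite subst_ren. symmetry. apply subst_id. now intros [|k].
Qed.

Lemma convertible_conv n : forall a b, convertible n a b = true -> a ≡ b.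
Proof.
  induction n as [|n IH]; intros a b; cbn; [discriminate|].
  intros [H|H]%orb_prop; [apply internal_term_dec_bl in H as ->; apply C_refl|].
  eapply C_trans; [apply (whnf_conv n)|].
  eapply C_trans; [|apply C_sym, (whnf_conv n)].
  revert H. generalize (whnf n a) (whnf n b). clear a b. intros a b.
  intros [H|H]%orb_prop; [apply internal_term_dec_bl in H as ->; apply C_refl|].
  destruct a, b; try discriminate H;
    repeat match goal with
      | H : _ && _ = true |- _ => apply andb_prop in H as [? ?]
      end;
    solve
    [ conv_congr; apply IH; assumption
    | eapply C_trans; [apply conv_Lam | apply C_Lam; [apply C_refl | apply IH; assumption]]
    | eapply C_trans; [apply C_Lam; [apply C_refl | apply IH; eassumption] | apply C_eta]
    | apply C_sym; eapply C_trans;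
      [apply C_Lam; [apply C_refl | apply C_sym, IH; eassumption] | apply C_eta]
    | eapply C_trans; [apply C_CskIn, IH; eassumption | apply C_csk_eta]
    | apply C_sym; eapply C_trans;
      [apply C_CskIn, C_sym, IH; eassumption | apply C_csk_eta] ].
  Unshelve. all: exact Unit.
Qed.

(** * Types, inversion and well-formed contexts *)

Definition is_type (G : ctx) (A : term) : Prop := exists i, G ⊢ A : Univ i.

Lemma typing_cumul G A i j : i <= j -> G ⊢ A : Univ i -> G ⊢ A : Univ j.
Proof. induction 1; auto using T_cumul. Qed.

(** [T_conv] and [T_cumul] keep the term and change only its type, so the premises of a type former
    survive the induction up to their levels, without any injectivity of [≡]. *)
Lemma typing_inversion G t T : G ⊢ t : T ->
  match t with
  | Pi A B | Sig A B => is_type G A /\ is_type (G,, A) B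
  | Coprod A B => is_type G A /\ is_type G B
  | Id A a b => is_type G A /\ G ⊢ a : A /\ G ⊢ b : A
  | Trunc A => is_type G A
  | Sk A => is_type (lock G) A
  | Csk A => is_type (promote G) A
  | _ => True
  end.
Proof. unfold is_type; induction 1; eauto. Qed.

Ltac invert_type H := let i := fresh in destruct H as [i H]; apply typing_inversion in H; cbn in H.

Lemma is_type_Pi G A B : is_type G A -> is_type (G,, A) B -> is_type G (Pi A B).
Proof.
  intros [i H] [j K]. exists (max i j).
  apply T_Pi; [apply (typing_cumul _ _ i) | apply (typing_cumul _ _ j)]; auto; lia.
Qed.

Lemma is_type_wk G A mB : is_type G A -> is_type (mB :: G) A↑1.
Proof. intros [i H]. exists i. exact (typing_wk _ mB _ _ H). Qed.

Lemma is_type_subst D G s A : is_type D A -> substitution s D G -> is_type G (subst s A).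
Proof. intros [i H] Hs. exists i. exact (typing_substitution _ _ _ _ _ H Hs). Qed.

Lemma is_type_inst G A B a : is_type (G,, A) B -> G ⊢ a : A -> is_type G (inst B a).
Proof. intros [i H] Ha. exists i. exact (typing_inst _ _ _ _ _ H Ha). Qed.

Lemma is_type_unlock G A : is_type (lock G) A -> is_type G A.
Proof. intros [i H]. exists i. now apply typing_unlock. Qed.

Lemma is_type_promote G A : is_type G A -> is_type (promote G) A.
Proof. intros [i H]. exists i. now apply typing_promote. Qed.

Lemma is_type_Univ G i : is_type G (Univ i).
Proof. exists (S i). apply T_univ. Qed.
#[export] Hint Resolve is_type_Univ : core.

Lemma typing_pair_variables G A B : is_type G A -> is_type (G,, A) B ->
  G,, A,, B ⊢ Pair #1 #0 : (Sig A B)↑2.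
Proof.
  intros [l HA] [l' HB].
  assert (HB' : G,, A,, B,, A↑2 ⊢ ren (up_ren (Nat.add 2)) B : Univ l').
  { rewrite ren_as_subst. eapply (typing_renaming _ B (Univ l')); [exact HB|].
    exists (up_ren (Nat.add 2)). split; [reflexivity|]. intros [|k] m C; cbn [nth_error].
    - intros [= <- <-] _. exists Ordinary, A↑2. split; [reflexivity|]. split; [exact I|].
      unfold wk. rewrite !ren_ren. now apply ren_ext.
    - intros Hk _. exists m, C. split; [exact Hk|]. split; [now destruct m|].
      unfold wk. rewrite !ren_ren. now apply ren_ext. }
  eapply T_Pair; [exact HB' | |].
  - eapply T_var with (k := 1); [reflexivity | discriminate].
  - eapply T_eq; [eapply T_var with (k := 0); [reflexivity | discriminate]|].
    unfold inst, repl, wk. rewrite subst_ren, ren_as_subst. apply subst_ext. now intros [|k].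
Qed.

(** Unlike [wf], this admits hidden variables, without a condition on them, and is thus preserved by
    [lock] and [promote]. *)
Definition well_formed (G : ctx) : Prop := forall k m A, nth_error G k = Some (m, A) ->
  match m with
  | Crisp => is_type (lock G) A↑(S k)
  | Ordinary => is_type G A↑(S k)
  | Hidden => True
  end.

Lemma well_formed_cons G m A : well_formed G ->
  match m with Crisp => is_type (lock G) A | Ordinary => is_type G A | Hidden => True end ->
  well_formed ((m, A) :: G).
Proof.
  intros HG HA [|k] m' B; cbn [nth_error].
  - intros [= <- <-]. destruct m; [| |exact I]; now apply is_type_wk.
  - intros Hk. specialize (HG _ _ _ Hk). rewrite wk_S. destruct m'; [| |exact I]; now apply is_type_wk.
Qed.

Lemma well_formed_lock G : well_formed G -> well_formed (lock G).
Proof.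
  intros HG k m A Hk. destruct m; [| |exact I]; destruct (nth_lock _ _ _ _ Hk); try congruence.
  rewrite lock_lock. exact (HG _ _ _ H0).
Qed.

Lemma well_formed_promote G : well_formed G -> well_formed (promote G).
Proof.
  intros HG k m A Hk.
  destruct m; [| |exact I]; destruct (nth_promote _ _ _ _ Hk) as [? (m & Hm & ?)]; try congruence.
  rewrite lock_promote. specialize (HG _ _ _ Hm). destruct m; [| |congruence].
  - now apply is_type_promote, is_type_unlock.
  - now apply is_type_promote.
Qed.

(** * Type inference and checking *)

Definition is_supported (c : axiom) : bool :=
  match c with DetectContinuity _ | CrispProjective _ => false | _ => true end.

Notation "'let?' p := e 'in' f" := (match e with p => f | _ => None end)
  (at level 200, p pattern, e at level 200, f at level 200).
Notation "'assert?' e 'in' f" := (if e then f else None)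
  (at level 200, e at level 200, f at level 200).

Section Judgments.

  Variable infer : ctx -> term -> option term.
  Variable fuel : nat.

  Definition infer_sort (G : ctx) (A : term) : option nat :=
    let? Some T := infer G A in
    let? Univ l := whnf fuel T in
    Some l.

  Definition is_sort (G : ctx) (A : term) : bool :=
    match infer_sort G A with Some _ => true | None => false end.

  (** Brings a type to weak head normal form; since subject reduction is not
      available, the result is checked to be a type again. *)
  Definition expose (G : ctx) (T : term) : option term :=
    match T with
    | Pi _ _ | Sig _ _ | Coprod _ _ | Id _ _ _ | Trunc _ | Sk _ | Csk _ => Some T
    | _ => let T' := whnf fuel T in assert? is_sort G T' in Some T'
    end.

  Definition subtype (T T' : term) : bool :=
    convertible fuel T T' ||
    match whnf fuel T, whnf fuel T' with
    | Univ l, Univ l' => level_le l l'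
    | _, _ => false
    end.

  Definition check_inferred (G : ctx) (t T : term) : bool :=
    match infer G t with Some T' => subtype T' T | None => false end.

  Fixpoint check (G : ctx) (t T : term) : bool :=
    match t with
    | Lam A b =>
        match expose G T with
        | Some (Pi A' B) => is_sort G A && convertible fuel A A' && check (G,, A') b B
        | _ => false
        end
    | Pair a b =>
        match expose G T with
        | Some (Sig A B) => check G a A && check G b (inst B a)
        | _ => false
        end
    | Inl a =>
        match expose G T with Some (Coprod A B) => check G a A | _ => false end
    | Inr b =>
        match expose G T with Some (Coprod A B) => check G b B | _ => false end
    | _ => check_inferred G t T
    end.

  (** A beta-redex that serves as a type annotation. Pairs and injections do not determine their
      types, so their types are inferred only in this form. *)
  Definition cast (T t : term) : term := App (Lam T #0) t.

  Definition infer_step (G : ctx) (t : term) : option term :=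
    match t with
    | Var k =>
        let? Some (m, A) := nth_error G k in
        match m with Hidden => None | _ => Some A↑(S k) end
    | Univ l => Some (Univ (S (S l)))
    | Pi A B | Sig A B =>
        let? Some l := infer_sort G A in
        let? Some l' := infer_sort (G,, A) B in
        Some (Univ (level_max l l'))
    | Lam A t =>
        assert? is_sort G A in
        let? Some B := infer (G,, A) t in
        Some (Pi A B)
    | App f a =>
        let? Some T := infer G f in
        let? Some (Pi A B) := expose G T in
        assert? check G a A in
        Some (inst B a)
    | Split C t p =>
        let? Some T := infer G p in
        let? Some (Sig A B) := expose G T in
        assert? is_sort (G,, Sig A B) C in
        assert? check (G,, A,, B) t (repl 2 (cast (Sig A B)↑2 (Pair #1 #0)) C) in
        Some (inst C p)
    | Coprod A B =>
        let? Some l := infer_sort G A in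
        let? Some l' := infer_sort G B in
        Some (Univ (level_max l l'))
    | Case C l r s =>
        let? Some T := infer G s in
        let? Some (Coprod A B) := expose G T in
        assert? is_sort (G,, Coprod A B) C in
        assert? check (G,, A) l (repl 1 (cast (Coprod A B)↑1 (Inl #0)) C) in
        assert? check (G,, B) r (repl 1 (cast (Coprod A B)↑1 (Inr #0)) C) in
        Some (inst C s)
    | Unit | Empty | Nat | Delta1 => Some (Univ 0)
    | Tt => Some Unit
    | UnitInd C t u =>
        assert? is_sort (G,, Unit) C in
        assert? check G t (inst C Tt) in
        assert? check G u Unit in
        Some (inst C u)
    | EmptyInd C e =>
        assert? is_sort (G,, Empty) C in
        assert? check G e Empty in
        Some (inst C e)
    | Zero => Some Nat
    | Succ n => assert? check G n Nat in Some Nat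
    | NatInd C z s n =>
        assert? is_sort (G,, Nat) C in
        assert? check G z (inst C Zero) in
        assert? check (G,, Nat,, C) s (repl 2 (Succ #1) C) in
        assert? check G n Nat in
        Some (inst C n)
    | Id A a b =>
        let? Some l := infer_sort G A in
        assert? check G a A in
        assert? check G b A in
        Some (Univ l)
    | Refl a => let? Some A := infer G a in Some (Id A a a)
    | J C c p =>
        let? Some T := infer G p in
        let? Some (Id A a b) := expose G T in
        assert? is_sort (G,, A,, Id A↑1 a↑1 #0) C in
        assert? check G c (inst2 C a (Refl a)) in
        Some (inst2 C b p)
    | Trunc A => let? Some l := infer_sort G A in Some (Univ l)
    | TrIn a => let? Some A := infer G a in Some (Trunc A)
    | TrPath x y =>
        let? Some T := infer G x in
        let? Some (Trunc A) := expose G T in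
        assert? check G y (Trunc A) in
        Some (Id (Trunc A) x y)
    | TrRec h f t =>
        let? Some T := infer G t in
        let? Some (Trunc A) := expose G T in
        let? Some F := infer G f in
        let? Some (Pi _ B0) := expose G F in
        (* The codomain is expected not to depend on its variable; [Tt] is a dummy that removes it,
           and [f] is checked against [Arr A B] afterwards. *)
        let B := inst B0 Tt in
        assert? is_sort G B in
        assert? check G h (IsProp B) in
        assert? check G f (Arr A B) in
        Some B
    | Sk A => let? Some l := infer_sort (lock G) A in Some (Univ l)
    | SkIn a => let? Some A := infer (lock G) a in Some (Sk A)
    | SkLet C N M =>
        let? Some T := infer G M in
        let? Some (Sk A) := expose G T in
        assert? is_sort (G,, Sk A) C in
        assert? check (G,; A) N (repl 1 (SkIn #0) C) in
        Some (inst C M)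
    | Csk A => let? Some l := infer_sort (promote G) A in Some (Univ l)
    | CskIn a => let? Some A := infer (promote G) a in Some (Csk A)
    | CskOut u =>
        let? Some T := infer (lock G) u in
        let? Some (Csk A) := expose (lock G) T in
        Some A
    | D0 | D1 => Some Delta1
    | Le x y =>
        assert? check G x Delta1 in
        assert? check G y Delta1 in
        Some (Univ 0)
    | Ax c =>
        assert? is_supported c in
        assert? is_sort G (axiom_type c) in
        Some (axiom_type c)
    | Pair _ _ | Inl _ | Inr _ => None
    end.

End Judgments.

Fixpoint infer (fuel : nat) (G : ctx) (t : term) : option term :=
  match fuel with
  | 0 => None
  | S n => infer_step (infer n) n G t
  end.

(** * Soundness of the checker for every value of [i] *)

Section Soundness.

  Variable i : nat.
  Let d := decode i.
  Let dG := decode_ctx i.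

  Lemma decode_lock G : dG (lock G) = lock (dG G).
  Proof. unfold dG, decode_ctx, lock. rewrite !map_map. apply map_ext. now intros [[] A]. Qed.

  Lemma decode_promote G : dG (promote G) = promote (dG G).
  Proof. unfold dG, decode_ctx, promote. rewrite !map_map. apply map_ext. now intros [[] A]. Qed.

  (** Inverting an inferred type requires that it be a type, so this is carried along with the
      typing. *)
  Definition sound (inf : ctx -> term -> option term) : Prop := forall G t T,
    inf G t = Some T -> well_formed (dG G) -> dG G ⊢ d t : d T /\ is_type (dG G) (d T).

  Variable inf : ctx -> term -> option term.
  Variable fuel : nat.
  Hypothesis inf_sound : sound inf.

  Lemma infer_sort_sound G A l : infer_sort inf fuel G A = Some l -> well_formed (dG G) ->
    dG G ⊢ d A : Univ (level i l).
  Proof.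
    unfold infer_sort. intros H HG. destruct (inf G A) as [T|] eqn:E; [|discriminate].
    destruct (inf_sound _ _ _ E HG) as [H1 _].
    pose proof (conv_decode i _ _ (whnf_conv fuel T)) as Hc.
    destruct (whnf fuel T); try discriminate. injection H as ->.
    eapply T_conv; [exact H1 | exact Hc | apply T_univ].
  Qed.

  Lemma is_sort_sound G A : is_sort inf fuel G A = true -> well_formed (dG G) ->
    is_type (dG G) (d A).
  Proof.
    unfold is_sort. intros H HG. destruct (infer_sort inf fuel G A) eqn:E; [|discriminate].
    eexists. eapply infer_sort_sound; eassumption.
  Qed.

  Lemma expose_conv G T T' : expose inf fuel G T = Some T' -> T ≡ T'.
  Proof.
    unfold expose. intros H. destruct T; try (injection H as <-; apply C_refl);
      destruct is_sort in H; try discriminate; injection H as <-; apply whnf_conv.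
  Qed.

  Lemma is_type_expose G T T' : expose inf fuel G T = Some T' -> well_formed (dG G) ->
    is_type (dG G) (d T) -> is_type (dG G) (d T').
  Proof.
    intros H HG HT. unfold expose in H. destruct T; try (injection H as <-; assumption);
      destruct is_sort eqn:E in H; try discriminate; injection H as <-; now apply is_sort_sound.
  Qed.

  Lemma typing_subtype G t T T' : subtype fuel T T' = true ->
    G ⊢ t : d T -> is_type G (d T') -> G ⊢ t : d T'.
  Proof.
    intros [H|H]%orb_prop Ht [l HT'].
    - apply convertible_conv, (conv_decode i) in H. eapply T_conv; eassumption.
    - pose proof (conv_decode i _ _ (whnf_conv fuel T)) as K.
      pose proof (conv_decode i _ _ (whnf_conv fuel T')) as K'.
      destruct (whnf fuel T); try discriminate H.
      destruct (whnf fuel T'); try discriminate H.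
      apply (level_le_sound i) in H.
      eapply T_conv; [|apply C_sym; exact K' | exact HT'].
      eapply typing_cumul; [exact H|]. eapply T_conv; [exact Ht | exact K | apply T_univ].
  Qed.

  Lemma check_inferred_sound G t T : check_inferred inf fuel G t T = true ->
    well_formed (dG G) -> is_type (dG G) (d T) -> dG G ⊢ d t : d T.
  Proof.
    unfold check_inferred. intros H HG HT. destruct (inf G t) eqn:E; [|discriminate].
    eapply typing_subtype; [eassumption | | assumption]. now apply inf_sound.
  Qed.

  (** The body of an abstraction is checked under the expected domain [A'], whereas [T_Lam] asks for
      the domain [A] that is written in the term. *)
  Lemma typing_conv_context G A A' t B : A ≡ A' -> is_type G A' -> G,, A' ⊢ t : B -> G,, A ⊢ t : B.
  Proof.
    intros HA [l HA'] Ht.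
    assert (Hs : substitution Var (G,, A') (G,, A)).
    { intros [|k] m C; cbn [nth_error].
      - intros [= <- <-]. rewrite subst_id by reflexivity. 
        eapply T_conv; [eapply T_var with (k := 0); [reflexivity | discriminate] | |
          exact (typing_wk _ _ _ _ HA')].
        unfold wk. rewrite !ren_as_subst. now apply conv_subst.
      - exact (substitution_var (G,, A) (S k) m C). }
    pose proof (typing_substitution _ _ _ _ _ Ht Hs) as K. now rewrite !subst_id in K.
  Qed.

  Lemma check_sound t : forall G T, check inf fuel G t T = true -> well_formed (dG G) ->
    is_type (dG G) (d T) -> dG G ⊢ d t : d T.
  Proof.
    induction t; intros G T H HG HT;
      try (apply check_inferred_sound; assumption);
      cbn in H; destruct (expose inf fuel G T) as [T'|] eqn:E; try discriminate H;
      destruct T'; try discriminate H; 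
      pose proof (conv_decode i _ _ (expose_conv _ _ _ E)) as Hc;
      pose proof (is_type_expose _ _ _ E HG HT) as HT';
      pose proof HT' as HS; invert_type HS; destruct HT as [lT HT];
      (eapply T_conv; [|apply C_sym; exact Hc | exact HT]).
    - destruct HS as [HA HB].
      apply andb_prop in H as [[H1 H2]%andb_prop H3].
      apply is_sort_sound in H1 as [l H1]; [|assumption].
      apply convertible_conv, (conv_decode i) in H2.
      apply IHt2 in H3; [|now apply well_formed_cons | exact HB].
      destruct HT' as [l' HT']. eapply T_conv; [| |exact HT'].
      + eapply T_Lam; [exact H1|]. eapply typing_conv_context; [exact H2 | exact HA | exact H3].
      + apply C_Pi; [exact H2 | apply C_refl].
    - destruct HS as [HA HB].
      apply andb_prop in H as [Ha Hb].
      apply IHt1 in Ha; [|assumption|assumption].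
      apply IHt2 in Hb; [|assumption|].
      + destruct HB as [l HB]. eapply T_Pair; [exact HB | exact Ha |]. now rewrite <- decode_inst.
      + unfold d. rewrite decode_inst. eapply is_type_inst; [exact HB | exact Ha].
    - destruct HS as [HA [l HB]]. eapply T_Inl; [exact HB|]. now apply IHt.
    - destruct HS as [[l HA] HB]. eapply T_Inr; [exact HA|]. now apply IHt.
  Qed.

  (** For the two excluded axioms this fails in general: their types mention the level [S k],
      whereas the code of the level after [k] is [S (S k)]. *)
  Lemma is_supported_decode c : is_supported c = true ->
    decode i (axiom_type c) = axiom_type (decode_axiom i c).
  Proof. destruct c; discriminate || reflexivity. Qed.

  Lemma conv_cast T t : cast T t ≡ t.
  Proof. apply C_beta. Qed.

  Lemma repl_cast k T t C : repl k (cast T t) C ≡ repl k t C.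
  Proof. apply conv_subst_pointwise. intros [|j]; [apply conv_cast | apply C_refl]. Qed.

  Lemma typing_cast G T t : is_type G T -> G ⊢ t : T -> G ⊢ cast T t : T.
  Proof.
    intros [l HT] Ht. eapply T_eq.
    - eapply T_App; [|exact Ht]. eapply T_Lam; [exact HT|].
      eapply T_var with (k := 0); [reflexivity | discriminate].
    - apply inst_wk.
  Qed.

  Lemma substitution_repl D G A t m :
    substitution (fun j => #(length D + j)) G (D ++ G) ->
    match m with Crisp => False | _ => D ++ G ⊢ t : subst (fun j => #(length D + j)) A end ->
    substitution (fun j => match j with 0 => t | S j => #(length D + j) end) ((m, A) :: G) (D ++ G).
  Proof.
    intros HG Ht. eapply substitution_cons with (s := fun j => #(length D + j));
      [exact HG | | reflexivity]. now destruct m.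
  Qed.

  Lemma substitution_weaken D G : substitution (fun j => #(length D + j)) G (D ++ G).
  Proof.
    induction D as [|mA D IH]; cbn; [apply substitution_var|].
    intros k m A Hk. specialize (IH _ _ _ Hk).
    replace (subst _ _) with (subst (fun j => #(length D + j)) A↑(S k))↑1
      by (unfold wk; rewrite ren_subst; now apply subst_ext).
    destruct m; [exact (typing_wk _ _ _ _ IH) | exact (typing_wk _ _ _ _ IH) | exact I].
  Qed.

  Lemma subst_as_wk n A : subst (fun j => #(n + j)) A = A↑n.
  Proof. unfold wk. now rewrite ren_as_subst. Qed.

  Lemma is_type_repl D G A C t : is_type (G,, A) C -> D ++ G ⊢ t : A↑(length D) ->
    is_type (D ++ G) (repl (length D) t C).
  Proof.
    intros HC Ht. eapply is_type_subst; [exact HC|].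
    apply substitution_repl; [apply substitution_weaken | now rewrite subst_as_wk].
  Qed.

  (** Branches of [Split] and [Case] are checked against the motive at a cast pair or injection,
      because the bare one could not be inferred inside the motive. The cast is then removed by a
      conversion. *)
  Lemma check_repl D G A C t e :
    check inf fuel (D ++ G) e (repl (length D) (cast A↑(length D) t) C) = true ->
    well_formed (dG (D ++ G)) -> is_type (dG (D ++ G)) (d A)↑(length D) ->
    dG (D ++ G) ⊢ d t : (d A)↑(length D) ->
    is_type (dG G,, d A) (d C) ->
    dG (D ++ G) ⊢ d e : repl (length D) (d t) (d C).
  Proof.
    intros H HG HA Ht HC.
    assert (E : dG (D ++ G) = dG D ++ dG G) by apply map_app.
    assert (L : length (dG D) = length D) by apply length_map.
    rewrite <- L in *.
    eapply check_sound in H; [|assumption|].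
    - unfold d in H. rewrite decode_repl in H. cbn in H. rewrite decode_wk, E in H.
      rewrite E in Ht |- *.
      destruct (is_type_repl _ _ _ _ _ HC Ht) as [l K].
      eapply T_conv; [exact H | apply repl_cast | exact K].
    - unfold d. rewrite decode_repl. cbn. rewrite decode_wk, E. rewrite E in HA, Ht.
      eapply is_type_repl; [exact HC|]. now apply typing_cast.
  Qed.

  Lemma is_type_inst2 G A B C a b : is_type (G,, A,, B) C -> G ⊢ a : A -> G ⊢ b : inst B a ->
    is_type G (inst2 C a b).
  Proof.
    intros HC Ha Hb. eapply is_type_subst; [exact HC|].
    eapply substitution_cons with (m := Ordinary)
      (s := fun j => match j with 0 => a | S j => #j end);
      [now apply (substitution_inst G A) | exact Hb | reflexivity].
  Qed.

  Ltac step H := match type of H with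
    | match ?e with _ => _ end = Some _ => is_var e; destruct e; try discriminate H
    | match ?e with _ => _ end = Some _ => let E := fresh "E" in destruct e eqn:E; try discriminate H
    end.
  Ltac steps H := repeat step H; try discriminate H; try (injection H as <-).

  Lemma infer_type G t T : inf G t = Some T -> well_formed (dG G) -> is_type (dG G) (d T).
  Proof. intros. now apply (inf_sound _ t). Qed.

  Lemma infer_typing G t T : inf G t = Some T -> well_formed (dG G) -> dG G ⊢ d t : d T.
  Proof. intros. now apply inf_sound. Qed.

  Lemma infer_expose G t T T' :
    inf G t = Some T -> expose inf fuel G T = Some T' -> well_formed (dG G) ->
    dG G ⊢ d t : d T' /\ is_type (dG G) (d T').
  Proof.
    intros H E HG. pose proof (is_type_expose _ _ _ E HG (infer_type _ _ _ H HG)) as [l HT'].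
    split; [|now exists l].
    eapply T_conv; [exact (infer_typing _ _ _ H HG) | exact (conv_decode i _ _ (expose_conv _ _ _ E))
      | exact HT'].
  Qed.

  Lemma sort_type G A l : infer_sort inf fuel G A = Some l -> well_formed (dG G) ->
    is_type (dG G) (d A).
  Proof. intros. eexists. eapply infer_sort_sound; eassumption. Qed.

  Lemma infer_step_sound : sound (infer_step inf fuel).
  Proof.
    intros G t T H HG. revert H.
    assert (HC : forall m A, match m with Crisp => is_type (dG (lock G)) (d A)
      | Ordinary => is_type (dG G) (d A) | Hidden => True end -> well_formed (dG ((m, A) :: G))).
    { intros m A HA. apply well_formed_cons; [exact HG|]. destruct m; auto.
      now rewrite <- decode_lock. }
    assert (HL : well_formed (dG (lock G))) by (rewrite decode_lock; now apply well_formed_lock).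
    assert (HP : well_formed (dG (promote G)))
      by (rewrite decode_promote; now apply well_formed_promote).
    destruct t; cbn [infer_step]; intros H; steps H.
    1, 2: rename t into A; rename E into Hk.
    1, 2: match type of Hk with _ = Some (?m, _) =>
        assert (E : nth_error (dG G) k = Some (m, d A))
          by (unfold dG, decode_ctx; now rewrite nth_error_map, Hk) end;
      unfold d; rewrite decode_wk; split; [eapply T_var; [exact E | discriminate]|];
      specialize (HG _ _ _ E); auto using is_type_unlock.
    - split; [|apply is_type_Univ]. unfold d; cbn [decode]. rewrite level_SS. apply T_univ.
    - split; [|apply is_type_Univ]. pose proof (HC Ordinary _ (sort_type _ _ _ E HG)) as HA.
      eapply infer_sort_sound in E, E0; try assumption.
      apply T_Pi; [eapply typing_cumul, E | eapply typing_cumul, E0];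
        [apply level_max_l | apply level_max_r].
    - apply is_sort_sound in E; [|assumption]. pose proof (HC Ordinary _ E) as HA.
      split.
      + destruct E as [l E]. eapply T_Lam; [exact E|]. exact (infer_typing _ _ _ E0 HA).
      + apply is_type_Pi; [exact E|]. exact (infer_type _ _ _ E0 HA).
    - destruct (infer_expose _ _ _ _ E E0 HG) as [Hf HT].
      invert_type HT. destruct HT as [HA HB].
      apply check_sound in E1; [|assumption|assumption].
      unfold d. rewrite decode_inst. split.
      + eapply T_App; [exact Hf | exact E1].
      + eapply is_type_inst; eassumption.
    - split; [|apply is_type_Univ]. pose proof (HC Ordinary _ (sort_type _ _ _ E HG)) as HA.
      eapply infer_sort_sound in E, E0; try assumption.
      apply T_Sig; [eapply typing_cumul, E | eapply typing_cumul, E0];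
        [apply level_max_l | apply level_max_r].
    - lazymatch type of E0 with _ = Some (Sig ?X ?Y) => rename X into A, Y into B end.
      destruct (infer_expose _ _ _ _ E E0 HG) as [Hp HS].
      pose proof (HC Ordinary _ HS) as HW. apply is_sort_sound in E1; [|assumption].
      pose proof HS as HAB. invert_type HAB. destruct HAB as [HA HB].
      assert (HW2 : well_formed (dG (G,, A,, B))).
      { apply well_formed_cons; [now apply (HC Ordinary) | exact HB]. }
      apply (check_repl [(Ordinary, B); (Ordinary, A)] G (Sig A B)) in E2; [|assumption|..|exact E1].
      + unfold d. rewrite decode_inst. destruct E1 as [l E1]. split.
        * eapply T_Split; [exact E1 | exact E2 | exact Hp].
        * eapply is_type_inst; [|exact Hp]. now exists l.
      + eapply (is_type_wk _ _ (Ordinary, d A)), (is_type_wk _ _ (Ordinary, d B)) in HS.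
        rewrite <- wk_S in HS. exact HS.
      + now apply typing_pair_variables.
    - split; [|apply is_type_Univ].
      eapply infer_sort_sound in E, E0; try assumption.
      apply T_Coprod; [eapply typing_cumul, E | eapply typing_cumul, E0];
        [apply level_max_l | apply level_max_r].
    - lazymatch type of E0 with _ = Some (Coprod ?X ?Y) => rename X into A, Y into B end.
      destruct (infer_expose _ _ _ _ E E0 HG) as [Hp HS].
      pose proof (HC Ordinary _ HS) as HW. apply is_sort_sound in E1; [|assumption].
      pose proof HS as HAB. invert_type HAB. destruct HAB as [HA HB].
      pose proof (is_type_wk _ _ (Ordinary, d A) HA) as [la HAA].
      pose proof (is_type_wk _ _ (Ordinary, d B) HA) as [lb HBA].
      pose proof (is_type_wk _ _ (Ordinary, d A) HB) as [lc HAB].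
      pose proof (is_type_wk _ _ (Ordinary, d B) HB) as [ld HBB].
      apply (check_repl [(Ordinary, A)] G (Coprod A B)) in E2;
        [|now apply (HC Ordinary)|exact (is_type_wk _ _ _ HS)| |exact E1].
      2: { eapply T_Inl; [exact HAB|]. eapply T_var with (k := 0); [reflexivity | discriminate]. }
      apply (check_repl [(Ordinary, B)] G (Coprod A B)) in E3;
        [|now apply (HC Ordinary)|exact (is_type_wk _ _ _ HS)| |exact E1].
      2: { eapply T_Inr; [exact HBA|]. eapply T_var with (k := 0); [reflexivity | discriminate]. }
      unfold d. rewrite decode_inst. destruct E1 as [l E1]. split.
      + eapply T_Case; [exact E1 | exact E2 | exact E3 | exact Hp].
      + eapply is_type_inst; [|exact Hp]. now exists l.
    - split; [apply T_Unit | apply is_type_Univ].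
    - split; [apply T_Tt | exists 0; apply T_Unit].
    - assert (HU : is_type (dG G) (d Unit)) by (exists 0; apply T_Unit).
      pose proof (HC Ordinary Unit HU) as HW. apply is_sort_sound in E; [|assumption].
      apply check_sound in E1; [|assumption|assumption].
      apply check_sound in E0; [|assumption|].
      2: { unfold d. rewrite decode_inst. eapply is_type_inst; [exact E | apply T_Tt]. }
      unfold d in *. rewrite decode_inst in *. destruct E as [l E]. split.
      + eapply T_UnitInd; eassumption.
      + eapply is_type_inst; [|exact E1]. now exists l.
    - split; [apply T_Empty | apply is_type_Univ].
    - assert (HU : is_type (dG G) (d Empty)) by (exists 0; apply T_Empty).
      pose proof (HC Ordinary Empty HU) as HW. apply is_sort_sound in E; [|assumption].
      apply check_sound in E0; [|assumption|assumption].
      unfold d in *. rewrite decode_inst in *. destruct E as [l E]. split.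
      + eapply T_EmptyInd; eassumption.
      + eapply is_type_inst; [|exact E0]. now exists l.
    - split; [apply T_Nat | apply is_type_Univ].
    - split; [apply T_Zero | exists 0; apply T_Nat].
    - apply check_sound in E; [|assumption | exists 0; apply T_Nat].
      split; [now apply T_Succ | exists 0; apply T_Nat].
    - assert (HU : is_type (dG G) (d Nat)) by (exists 0; apply T_Nat).
      pose proof (HC Ordinary Nat HU) as HW. apply is_sort_sound in E; [|assumption].
      apply check_sound in E2; [|assumption|assumption].
      apply check_sound in E0; [|assumption|].
      2: { unfold d. rewrite decode_inst. eapply is_type_inst; [exact E | apply T_Zero]. }
      apply check_sound in E1; [|now apply well_formed_cons|].
      2: { unfold d. rewrite decode_repl.
        eapply (is_type_repl [_; _]); [exact E|]. apply T_Succ.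
        eapply T_eq; [eapply T_var with (k := 1); [reflexivity | discriminate] | reflexivity]. }
      unfold d in *. rewrite decode_inst, ?decode_repl in *. destruct E as [l E]. split.
      + eapply T_NatInd; eassumption.
      + eapply is_type_inst; [|exact E2]. now exists l.
    - split; [|apply is_type_Univ]. pose proof (sort_type _ _ _ E HG) as HA.
      eapply infer_sort_sound in E; try assumption.
      apply check_sound in E0, E1; try assumption.
      now apply T_Id.
    - pose proof (infer_type _ _ _ E HG) as [l HA]. apply infer_typing in E; [|assumption].
      split; [now apply T_Refl|]. exists l. now apply T_Id.
    - lazymatch type of E0 with _ = Some (Id ?X ?Y ?Z) => rename X into A, Y into a, Z into b end.
      destruct (infer_expose _ _ _ _ E E0 HG) as [Hp HS].
      pose proof HS as HAB. invert_type HAB. destruct HAB as (HA & Ha & Hb).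
      assert (HR : dG G ⊢ Refl (d a) : inst (Id (d A)↑1 (d a)↑1 #0) (d a)).
      { eapply T_eq; [apply T_Refl; exact Ha|]. unfold inst, repl. cbn.
        f_equal; symmetry; apply inst_wk. }
      assert (Hp' : dG G ⊢ d t3 : inst (Id (d A)↑1 (d a)↑1 #0) (d b)).
      { eapply T_eq; [exact Hp|]. unfold inst, repl. cbn.
        f_equal; symmetry; apply inst_wk. }
      pose proof (HC Ordinary _ HA) as HW.
      assert (HI : is_type (dG (G,, A)) (d (Id A↑1 a↑1 #0))).
      { destruct HA as [l HA]. exists l. unfold d. cbn. rewrite !decode_wk.
        apply T_Id; [exact (typing_wk _ _ _ _ HA) | exact (typing_wk _ _ _ _ Ha)
          | eapply T_var with (k := 0); [reflexivity | discriminate]]. }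
      apply is_sort_sound in E1; [|now apply well_formed_cons].
      cbn in E1. unfold d in E1. cbn in E1. rewrite !decode_wk in E1.
      apply check_sound in E2; [|assumption|].
      2: { unfold d. rewrite decode_inst2. eapply is_type_inst2; [exact E1 | exact Ha | exact HR]. }
      unfold d in *. rewrite decode_inst2 in *. split.
      + destruct E1 as [l E1]. eapply T_J; eassumption.
      + eapply is_type_inst2; eassumption.
    - split; [|apply is_type_Univ]. eapply infer_sort_sound in E; try assumption. now apply T_Trunc.
    - pose proof (infer_type _ _ _ E HG) as [l HA]. apply infer_typing in E; [|assumption].
      split; [now apply T_TrIn|]. exists l. now apply T_Trunc.
    - destruct (infer_expose _ _ _ _ E E0 HG) as [Hx HT].
      apply check_sound in E1; [|assumption|assumption].
      split; [now apply T_TrPath|]. destruct HT as [l HT]. exists l. now apply T_Id.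
    - lazymatch type of E0 with _ = Some (Trunc ?X) => rename X into A end.
      lazymatch type of E3 with is_sort _ _ _ ?X = _ => set (B := X) in * end.
      destruct (infer_expose _ _ _ _ E E0 HG) as [Ht HT]. invert_type HT.
      apply is_sort_sound in E3; [|assumption].
      assert (HV : forall G X, G,, X ⊢ #0 : X↑1)
        by (intros; eapply T_var with (k := 0); [reflexivity | discriminate]).
      apply check_sound in E4; [|assumption|].
      2: { unfold d. cbn. rewrite !decode_wk. apply is_type_Pi; [exact E3|].
        apply is_type_Pi; [now apply is_type_wk|].
        destruct E3 as [l E3]. exists l. rewrite (wk_S 1). apply T_Id.
        - exact (typing_wk _ _ _ _ (typing_wk _ _ _ _ E3)).
        - exact (typing_wk _ _ _ _ (HV _ _)).
        - apply HV. }
      apply check_sound in E5; [|assumption|].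
      2: { unfold d. cbn. rewrite decode_wk. apply is_type_Pi; [exact HT | now apply is_type_wk]. }
      split; [|exact E3]. eapply T_TrRec; [| |exact Ht].
      + eapply T_eq; [exact E4|]. unfold d. cbn. now rewrite !decode_wk.
      + eapply T_eq; [exact E5|]. unfold d. cbn. now rewrite decode_wk.
    - split; [|apply is_type_Univ]. eapply infer_sort_sound in E; try assumption.
      rewrite decode_lock in E. now apply T_Sk.
    - pose proof (infer_type _ _ _ E HL) as [l HA]. apply infer_typing in E; [|assumption].
      rewrite decode_lock in E, HA. split; [now apply T_SkIn|]. exists l. now apply T_Sk.
    - lazymatch type of E0 with _ = Some (Sk ?X) => rename X into A end.
      destruct (infer_expose _ _ _ _ E E0 HG) as [Hp HS].
      pose proof (HC Ordinary _ HS) as HW. apply is_sort_sound in E1; [|assumption].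
      pose proof HS as HA. invert_type HA.
      assert (HW2 : well_formed (dG (G,; A))) by (apply (HC Crisp); now rewrite decode_lock).
      apply check_sound in E2; [|assumption|].
      2: { unfold d. rewrite decode_repl. eapply (is_type_repl [_]); [exact E1|].
        apply T_SkIn. eapply T_var with (k := 0); [reflexivity | discriminate]. }
      unfold d in *. rewrite decode_inst, ?decode_repl in *. destruct HA as [l HA]. split.
      + destruct E1 as [l' E1]. eapply T_SkLet; eassumption.
      + eapply is_type_inst; [exact E1 | exact Hp].
    - split; [|apply is_type_Univ]. eapply infer_sort_sound in E; try assumption.
      rewrite decode_promote in E. now apply T_Csk.
    - pose proof (infer_type _ _ _ E HP) as [l HA]. apply infer_typing in E; [|assumption].
      rewrite decode_promote in E, HA. split; [now apply T_CskIn|]. exists l. now apply T_Csk.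
    - destruct (infer_expose _ _ _ _ E E0 HL) as [Hu HT].
      rewrite decode_lock in Hu, HT. split; [now apply T_CskOut|].
      invert_type HT. rewrite promote_lock in HT. now apply is_type_unlock.
    - split; [apply T_Delta1 | apply is_type_Univ].
    - split; [apply T_D0 | exists 0; apply T_Delta1].
    - split; [apply T_D1 | exists 0; apply T_Delta1].
    - apply check_sound in E, E0; try assumption; try (exists 0; apply T_Delta1).
      split; [now apply T_Le | apply is_type_Univ].
    - apply is_sort_sound in E0; [|assumption]. split; [|exact E0].
      unfold d. rewrite is_supported_decode by assumption. apply T_ax.
  Qed.

End Soundness.

Lemma infer_sound i n : sound i (infer n).
Proof. induction n; [discriminate | now apply infer_step_sound]. Qed.

(** * Derivations that use previously checked lemmas *)

Lemma typing_closed G t A : G ⊢ t : A ->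
  forall s, (forall k, k < length G -> s k = #k) -> subst s t = t.
Proof.
  assert (U : forall n s, (forall k, k < n -> s k = #k) -> forall k, k < S n -> up s k = #k).
  { intros n s Hs [|k] Hk; cbn; [reflexivity|]. now rewrite Hs by lia. }
  induction 1; intros s' Hs; cbn; [apply Hs; apply nth_error_Some; congruence|..]; f_equal; auto 6;
    repeat match goal with
      IH : forall s, _ -> subst s ?t = _ |- subst _ ?t = _ => apply IH; cbn [length];
        unfold lock, promote; rewrite ?length_map; auto
    end; repeat (apply U); auto.
Qed.

Section Lemmas.

  Variable i : nat.

  Definition derivable (T : term) : Prop :=
    is_type [] (decode i T) /\ inhabited_in [] (decode i T).

  Definition lemma_context (S : list term) : ctx := map (pair Crisp) S.

  (** A crisp variable must receive a term over a locked context; the inhabitants of lemmas are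
      closed and so qualify. *)
  Lemma closing_substitution S : Forall derivable S ->
    exists s, substitution s (decode_ctx i (lemma_context S)) [].
  Proof.
    induction 1 as [|T S [[l HT] [t Ht]] _ [s IH]]; [exists Var; intros [|k]; discriminate|].
    eexists. eapply substitution_cons with (m := Crisp); [exact IH | exact Ht |].
    symmetry. apply (typing_closed _ _ _ HT). cbn; lia.
  Qed.

  Fixpoint check_context (n : nat) (G : ctx) : bool :=
    match G with
    | [] => true
    | (m, A) :: G =>
        check_context n G &&
        match m with
        | Crisp => is_sort (infer n) n (lock G) A
        | Ordinary => is_sort (infer n) n G A
        | Hidden => true
        end
    end.

  Lemma check_context_sound n G : check_context n G = true -> well_formed (decode_ctx i G).
  Proof.
    pose proof (infer_sound i n) as Hn.
    induction G as [|[m A] G IH]; cbn; [intros _ [|k]; discriminate|].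
    intros [HG HA]%andb_prop. specialize (IH HG). apply well_formed_cons; [exact IH|].
    destruct m; [| |exact I]; apply (is_sort_sound i _ _ Hn) in HA; auto.
    - now rewrite decode_lock in HA.
    - rewrite decode_lock. now apply well_formed_lock.
  Qed.

  Definition check_in (n : nat) (G : ctx) (t T : term) : bool :=
    check_context n G && is_sort (infer n) n G T && check (infer n) n G t T.

  Lemma check_in_sound n G t T : check_in n G t T = true ->
    is_type (decode_ctx i G) (decode i T) /\ decode_ctx i G ⊢ decode i t : decode i T.
  Proof.
    intros [[HG HT]%andb_prop Ht]%andb_prop. pose proof (infer_sound i n) as Hn.
    apply check_context_sound in HG.
    apply (is_sort_sound i _ _ Hn) in HT; [|exact HG]. split; [exact HT|].
    now apply (check_sound i _ n Hn).
  Qed.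

  (** The statement is checked in the empty context: it must not change when the lemmas used in its
      proof are replaced by their inhabitants. *)
  Definition check_lemma (n : nat) (S : list term) (t T : term) : bool :=
    is_sort (infer n) n [] T && check (infer n) n (lemma_context S) t T.

  Lemma well_formed_lemmas S : Forall derivable S -> well_formed (decode_ctx i (lemma_context S)).
  Proof.
    induction 1 as [|T S [[l HT] _] _ IH]; [intros [|k]; discriminate|].
    apply well_formed_cons; [exact IH|]. exists l. exact (typing_app_ctx [] _ _ _ HT).
  Qed.

  Lemma check_lemma_sound n S t T : check_lemma n S t T = true -> Forall derivable S ->
    Forall derivable (T :: S).
  Proof.
    intros [HT Ht]%andb_prop HS. constructor; [|assumption].
    pose proof (infer_sound i n) as Hn.
    apply (is_sort_sound i _ _ Hn) in HT; [|intros [|k]; discriminate].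
    pose proof (well_formed_lemmas S HS) as HW.
    eapply (check_sound i _ _ Hn) in Ht; [|exact HW|].
    - split; [exact HT|]. destruct (closing_substitution S HS) as [s Hs].
      exists (subst s (decode i t)).
      pose proof (typing_substitution _ _ _ _ _ Ht Hs) as K.
      destruct HT as [l HT]. now rewrite (typing_closed _ _ _ HT) in K by (cbn; lia).
    - destruct HT as [l HT]. exists l. exact (typing_app_ctx [] _ _ _ HT).
  Qed.

  Fixpoint check_lemmas (n : nat) (S : list term) (L : list (term * term)) : bool :=
    match L with
    | [] => true
    | (t, T) :: L => check_lemma n S t T && check_lemmas n (T :: S) L
    end.

  Lemma check_lemmas_sound n L : forall S, check_lemmas n S L = true -> Forall derivable S ->
    Forall derivable (rev_append (map snd L) S).
  Proof.
    induction L as [|[t T] L IH]; intros S; [auto|].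
    intros [H1 H2]%andb_prop HS. apply IH; [exact H2|]. eapply check_lemma_sound; eassumption.
  Qed.

End Lemmas.

Fixpoint lift (n : nat) (s : nat -> term) : nat -> term :=
  match n with 0 => s | S n => up (lift n s) end.

Fixpoint subst_ctx (s : nat -> term) (G : ctx) : ctx :=
  match G with
  | [] => []
  | (m, A) :: G => (m, subst (lift (length G) s) A) :: subst_ctx s G
  end.

Lemma substitution_lift s D E G : substitution s D E ->
  substitution (lift (length G) s) (G ++ D) (subst_ctx s G ++ E).
Proof.
  intros Hs. induction G as [|[m A] G IH]; [exact Hs|]. exact (substitution_up _ _ _ m A IH).
Qed.

(** The derivation of [t] may use the lemmas [L], listed from the oldest, which
    make up the end of its context. *)
Lemma check_derivation_sound i n L G t T : check_lemmas n [] L = true ->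
  check_in n (G ++ lemma_context (rev_append (map snd L) [])) t T = true ->
  exists s, inhabited_in (subst_ctx s (decode_ctx i G)) (subst (lift (length G) s) (decode i T)).
Proof.
  intros HL H. apply (check_lemmas_sound i) in HL; [|constructor].
  destruct (closing_substitution i _ HL) as [s Hs]. exists s, (subst (lift (length G) s) (decode i t)).
  apply (check_in_sound i) in H as [_ H].
  apply (substitution_lift _ _ _ (decode_ctx i G)) in Hs.
  unfold decode_ctx in H, Hs. rewrite map_app in H.
  rewrite app_nil_r, length_map in Hs.
  exact (typing_substitution _ _ _ _ _ H Hs).
Qed.

(** * The synthetic argument *)

(** The types of Rocq stand for those of the object theory. The fields of [Model] are
    the constants of the theory, [Type] is read as [Univ i], [U0] as [Univ 0] and
    [U2] as [Univ (i + 2)]. Rocq does not track crispness, which is left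
    to the type checker above: a definition in which [sk_in], [csk_out] or
    [sk_rect] is applied to its arguments may make sense only for crisp ones.
    Proofs use the eliminators [paths_rect], [sigT_rect], ..., never [match]. *)

Inductive paths {A : Type} (a : A) : A -> Type := idpath : paths a a.
Arguments idpath {A} a.
Notation "a == b" := (paths a b) (at level 70).

Inductive sk (A : Type) : Type := sk_in (a : A).
Arguments sk_in {A} a.

(** Primitive projections give [csk] its judgmental uniqueness rule in Rocq too, whereas [sk] has
    only its induction principle, as in the object theory. *)
#[projections(primitive)]
Record csk (A : Type) : Type := csk_in { csk_out : A }.
Arguments csk_in {A}.
Arguments csk_out {A}.

Definition U0 := Type.
Definition U2 := Type.

Definition pr1 {A} {B : A -> Type} (s : {x : A & B x}) : A :=
  sigT_rect (fun _ => A) (fun a _ => a) s.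
Definition pr2 {A} {B : A -> Type} (s : {x : A & B x}) : B (pr1 s) :=
  sigT_rect (fun s => B (pr1 s)) (fun _ b => b) s.
Notation "⟨ a , b ⟩" := (existT _ a b) (at level 0, a at level 200, b at level 200).
Notation "A × B" := {_ : A & B} (at level 40, left associativity).

Definition concat {A} {a b c : A} (p : a == b) (q : b == c) : a == c :=
  paths_rect A b (fun c _ => a == c) p c q.
Definition inv {A} {a b : A} (p : a == b) : b == a :=
  paths_rect A a (fun b _ => b == a) (idpath a) b p.
Definition ap {A B} (f : A -> B) {a b : A} (p : a == b) : f a == f b :=
  paths_rect A a (fun b _ => f a == f b) (idpath (f a)) b p.
Definition transport {A} (P : A -> Type) {a b : A} (p : a == b) (u : P a) : P b :=
  paths_rect A a (fun b _ => P b) u b p.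
Definition happly {A} {B : A -> Type} {f g : forall x, B x} (p : f == g) :
  forall x, f x == g x :=
  paths_rect _ f (fun g _ => forall x, f x == g x) (fun x => idpath (f x)) g p.

Definition absurd {A} (e : Empty_set) : A := Empty_set_rect (fun _ => A) e.

Definition is_equiv A B (f : A -> B) : Type :=
  {g : B -> A & forall b, f (g b) == b} × {h : B -> A & forall a, h (f a) == a}.
Definition equiv A B := {f : A -> B & is_equiv A B f}.
Definition is_prop A := forall a b : A, a == b.

Definition counit A (v : sk A) : A := sk_rect A (fun _ => A) (fun a => a) v.
Definition is_skeletal A := is_equiv (sk A) A (counit A).
Definition is_null D A := is_equiv A (D -> A) (fun a _ => a).

Class Model := {
  interval : U0;
  i0 : interval;
  i1 : interval;
  leq : interval -> interval -> U0;
  trunc : Type -> Type;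
  tr_in : forall A, A -> trunc A;
  tr_path : forall A (x y : trunc A), x == y;
  tr_rec : forall A B, is_prop B -> (A -> B) -> trunc A -> B;
  funext_equiv : forall A (B : A -> Type) (f g : forall x, B x),
    is_equiv (f == g) (forall x, f x == g x) happly;
  leq_prop : forall x y, is_prop (leq x y);
  leq_refl : forall x, leq x x;
  leq_trans : forall x y z, leq x y -> leq y z -> leq x z;
  leq_antisym : forall x y, leq x y -> leq y x -> x == y;
  leq_total : forall x y, trunc (sum (leq x y) (leq y x));
  leq_least : forall x, leq i0 x;
  leq_greatest : forall x, leq x i1;
  endpoints_distinct : i0 == i1 -> Empty_set;
  skeletal_iff_null : forall v : sk Type, sk_rect Type (fun _ => Type)
    (fun X => (is_skeletal X -> is_null interval X) × (is_null interval X -> is_skeletal X)) v;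
  endpoints_csk : forall x : interval, csk (trunc (sum (x == i0) (x == i1)))
}.

Section Synthetic.
Context {M : Model}.

(** * Function extensionality and isomorphisms *)

Definition funext A (B : A -> Type) (f g : forall x, B x) (h : forall x, f x == g x) : f == g :=
  pr1 (pr1 (funext_equiv A B f g)) h.

Lemma happly_funext A (B : A -> Type) (f g : forall x, B x) (h : forall x, f x == g x) x :
  happly (funext A B f g h) x == h x.
Proof. exact (happly (pr2 (pr1 (funext_equiv A B f g)) h) x). Defined.

(** Quasi-inverses are easier to invert and compose than bi-invertible maps, and suffice since only
    the existence of equivalences is claimed. *)
Definition iso A B : Type :=
  {f : A -> B & {g : B -> A & (forall b, f (g b) == b) × (forall a, g (f a) == a)}}.

Definition iso_fun {A B} (e : iso A B) : A -> B := pr1 e.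
Definition iso_inv {A B} (e : iso A B) : B -> A := pr1 (pr2 e).
Definition iso_sec {A B} (e : iso A B) b : iso_fun e (iso_inv e b) == b := pr1 (pr2 (pr2 e)) b.
Definition iso_ret {A B} (e : iso A B) a : iso_inv e (iso_fun e a) == a := pr2 (pr2 (pr2 e)) a.
Definition iso_make {A B} (f : A -> B) (g : B -> A)
  (s : forall b, f (g b) == b) (r : forall a, g (f a) == a) : iso A B :=
  existT (fun f => {g : B -> A & (forall b, f (g b) == b) × (forall a, g (f a) == a)}) f
    (existT (fun g => (forall b, f (g b) == b) × (forall a, g (f a) == a)) g ⟨s, r⟩).

Lemma iso_sym A B (e : iso A B) : iso B A.
Proof. exact (iso_make (iso_inv e) (iso_fun e) (iso_ret e) (iso_sec e)). Defined.

Lemma iso_trans A B C (e : iso A B) (e' : iso B C) : iso A C.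
Proof.
  refine (iso_make (fun a => iso_fun e' (iso_fun e a)) (fun c => iso_inv e (iso_inv e' c)) _ _).
  - intros c. exact (concat (ap (iso_fun e') (iso_sec e (iso_inv e' c))) (iso_sec e' c)).
  - intros a. exact (concat (ap (iso_inv e) (iso_ret e' (iso_fun e a))) (iso_ret e a)).
Defined.

Lemma iso_equiv A B (e : iso A B) : equiv A B.
Proof.
  exact ⟨iso_fun e, ⟨⟨iso_inv e, iso_sec e⟩, ⟨iso_inv e, iso_ret e⟩⟩⟩.
Defined.

(** With a right inverse [g] and a left inverse [h], one has [g (f a) == h (f (g (f a))) == h (f a)
    == a]. *)
Lemma equiv_iso A B (f : A -> B) (H : is_equiv A B f) : iso A B.
Proof.
  refine (iso_make f (pr1 (pr1 H)) (pr2 (pr1 H)) (fun a => _)).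
  refine (concat _ (pr2 (pr2 H) a)).
  refine (concat (inv (pr2 (pr2 H) (pr1 (pr1 H) (f a)))) _).
  exact (ap (pr1 (pr2 H)) (pr2 (pr1 H) (f a))).
Defined.

Lemma iso_sigma A (P Q : A -> Type) (e : forall a, iso (P a) (Q a)) :
  iso {a : A & P a} {a : A & Q a}.
Proof.
  refine (iso_make (fun s => existT Q (pr1 s) (iso_fun (e (pr1 s)) (pr2 s)))
    (fun s => existT P (pr1 s) (iso_inv (e (pr1 s)) (pr2 s))) _ _).
  - intros s. induction s as [a q] using sigT_rect. exact (ap (existT Q a) (iso_sec (e a) q)).
  - intros s. induction s as [a q] using sigT_rect. exact (ap (existT P a) (iso_ret (e a) q)).
Defined.

(** * Null types: closure under sums, path types and powers *)

Definition is_const (X : Type) : Type := forall (g : interval -> X) i, g i == g i0.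

Lemma null_const X (H : is_null interval X) : is_const X.
Proof.
  intros g i. exact (concat (inv (happly (pr2 (pr1 H) g) i)) (happly (pr2 (pr1 H) g) i0)).
Defined.

Lemma const_null X (H : is_const X) : is_null interval X.
Proof.
  exact ⟨⟨fun g => g i0, fun g => funext _ _ _ _ (fun i => inv (H g i))⟩,
    ⟨fun g => g i0, fun x => idpath x⟩⟩.
Defined.

Lemma sigma_eta A (P : A -> Type) (s : {a : A & P a}) : existT P (pr1 s) (pr2 s) == s.
Proof. induction s as [a u] using sigT_rect. exact (idpath _). Defined.

Lemma sigma_transport A (P : A -> Type) (s : {a : A & P a}) (a : A) (p : pr1 s == a) :
  s == existT P a (transport P p (pr2 s)).
Proof.
  induction p as [] using paths_rect. induction s as [a' u] using sigT_rect. exact (idpath _).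
Defined.

Lemma const_sigma A (P : A -> Type) (HA : is_const A) (HP : forall a, is_const (P a)) :
  is_const {a : A & P a}.
Proof.
  intros g i.
  pose (p := HA (fun i => pr1 (g i))).
  refine (concat (sigma_transport _ _ (g i) _ (p i)) _).
  (* The loop [p i0] need not be trivial, so the value at [i0] is transported as well; both ends
     then lie in the fibre over [pr1 (g i0)]. *)
  refine (concat _ (inv (sigma_transport _ _ (g i0) _ (p i0)))).
  exact (ap (existT P _) (HP _ (fun i => transport P (p i) (pr2 (g i))) i)).
Defined.

Lemma concat_inv A (a b : A) (p : a == b) : concat p (inv p) == idpath a.
Proof. induction p as [] using paths_rect. exact (idpath _). Defined.

Definition coherent_const D (d : D) X : Type :=
  {K : forall (g : D -> X) i, g i == g d & forall x i, K (fun _ => x) i == idpath x}.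

(** Dividing [K g i] by its value at a constant map makes it coherent. *)
Lemma make_coherent D (d : D) X (K : forall (g : D -> X) i, g i == g d) : coherent_const D d X.
Proof.
  exact ⟨fun g i => concat (K g i) (inv (K (fun _ => g d) i)),
    fun x i => concat_inv _ _ _ (K (fun _ => x) i)⟩.
Defined.

Lemma idpath_concat A (a b : A) (p : a == b) : concat (idpath a) p == p.
Proof. induction p as [] using paths_rect. exact (idpath _). Defined.

Lemma const_natural D (d : D) X (K : coherent_const D d X) (g h : D -> X) (p : g == h) i :
  concat (happly p i) (pr1 K h i) == concat (pr1 K g i) (happly p d).
Proof.
  induction p as [] using paths_rect.
  exact (idpath_concat _ _ _ (pr1 K g i)).
Defined.

(** By function extensionality, a map into [a == b] is a path between the constant maps at [a] and
    [b]. Naturality of [K] along this path compares its values at [i] and [i0], and coherence makes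
    [K] trivial at both constant maps. *)
Lemma const_paths A (HA : is_const A) (a b : A) : is_const (a == b).
Proof.
  intros g i.
  pose (K := make_coherent _ _ _ HA).
  pose (p := funext _ _ (fun _ => a) (fun _ => b) g).
  refine (concat (inv (happly_funext _ _ (fun _ => a) (fun _ => b) g i)) _).
  refine (concat _ (happly_funext _ _ (fun _ => a) (fun _ => b) g i0)).
  refine (concat _ (idpath_concat _ _ _ (happly p i0))).
  refine (concat _ (ap (fun q => concat q (happly p i0)) (pr2 K a i))).
  refine (concat _ (const_natural _ _ _ K _ _ p i)).
  exact (ap (concat (happly p i)) (inv (pr2 K b i))).
Defined.

Definition pow (A : Type) (n : nat) : Type := nat_rect (fun _ => Type) unit (fun _ P => A × P) n.

Lemma unit_path (x y : unit) : x == y.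
Proof.
  induction x using unit_rect. induction y using unit_rect. exact (idpath _).
Defined.

Lemma const_pow A (HA : is_const A) n : is_const (pow A n).
Proof.
  induction n as [|n IH] using nat_rect.
  - intros g i. exact (unit_path _ _).
  - exact (const_sigma _ _ HA (fun _ => IH)).
Defined.

(** * Propositional components, and meets in the interval *)

Lemma sigma_prop A (P : A -> Type) (HP : forall a, is_prop (P a)) (s t : {a : A & P a})
  (p : pr1 s == pr1 t) : s == t.
Proof.
  refine (concat (sigma_transport _ _ s _ p) _).
  refine (concat (ap (existT P _) (HP _ _ (pr2 t))) _).
  exact (inv (sigma_transport _ _ t _ (idpath _))).
Defined.

(** The last component makes [m] unique, so that the meet can be read off the
    truncated [leq_total]. *)
Definition is_meet t x m : Type := leq m x × (leq m t × trunc (sum (leq t m) (leq x m))).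

Lemma meet_leq t x m m' (H : is_meet t x m) (H' : is_meet t x m') : leq m m'.
Proof.
  refine (tr_rec _ _ (leq_prop _ _) _ (pr2 (pr2 H'))). intros c.
  induction c as [l|l] using sum_rect.
  - exact (leq_trans _ _ _ (pr1 (pr2 H)) l).
  - exact (leq_trans _ _ _ (pr1 H) l).
Defined.

Lemma meet t x : {m : interval & is_meet t x m}.
Proof.
  refine (tr_rec _ _ _ _ (leq_total t x)).
  - intros s s'.
    refine (sigma_prop _ _ _ _ _ (leq_antisym _ _ (meet_leq t x _ _ (pr2 s) (pr2 s'))
      (meet_leq t x _ _ (pr2 s') (pr2 s)))).
    intros m u u'. refine (sigma_prop _ _ _ _ _ (leq_prop _ _ _ _)). intros _ v v'.
    refine (sigma_prop _ _ _ _ _ (leq_prop _ _ _ _)). intros _ w w'. exact (tr_path _ _ _).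
  - intros c. induction c as [l|l] using sum_rect.
    + exact ⟨t, ⟨l, ⟨leq_refl t, tr_in _ (inl (leq_refl t))⟩⟩⟩.
    + exact ⟨x, ⟨leq_refl x, ⟨l, tr_in _ (inr (leq_refl x))⟩⟩⟩.
Defined.

(** * Simplices: connectedness and the last vertex *)

Definition ipow (n : nat) : U0 := nat_rect (fun _ => U0) unit (fun _ P => interval × P) n.
Definition leq_head (n : nat) : interval -> ipow n -> U0 :=
  nat_rect (fun n => interval -> ipow n -> U0) (fun _ _ => unit)
    (fun n _ x (v : interval × ipow n) => leq x (pr1 v)) n.
Definition sorted (n : nat) : ipow n -> U0 :=
  nat_rect (fun n => ipow n -> U0) (fun _ => unit)
    (fun n S (v : interval × ipow n) => leq_head n (pr1 v) (pr2 v) × S (pr2 v)) n.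
Definition simplex (n : nat) : Type := {v : ipow n & sorted n v}.

Lemma simplex0_path (d : simplex 0) : existT (sorted 0) tt tt == d.
Proof.
  refine (sigT_rect (fun d : simplex 0 => _ == d) (fun v s => _) d).
  induction v using unit_rect. induction s using unit_rect. exact (idpath _).
Defined.

Lemma leq_head_prop n x v : is_prop (leq_head n x v).
Proof.
  induction n as [|n _] using nat_rect.
  - exact unit_path.
  - exact (leq_prop _ _).
Defined.

Definition leq_head_least n v : leq_head n i0 v.
Proof.
  induction n as [|n _] using nat_rect.
  - exact tt.
  - exact (leq_least _).
Defined.

Lemma leq_head_trans n x y v (l : leq x y) (m : leq_head n y v) : leq_head n x v.
Proof.
  induction n as [|n _] using nat_rect.
  - exact tt.
  - exact (leq_trans _ _ _ l m).
Defined.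

(** The line [t |-> min t x] joins [x] to [i0] inside [{x | x <= v_1}]. *)
Lemma cone_const n v Y (HY : is_const Y) (h : {x : interval & leq_head n x v} -> Y) s :
  h s == h ⟨i0, leq_head_least n v⟩.
Proof.
  pose (m := fun t => pr1 (meet t (pr1 s))).
  pose (P := fun t => pr2 (meet t (pr1 s))).
  pose (k := fun t => existT (fun x => leq_head n x v) (m t)
    (leq_head_trans n _ _ v (pr1 (P t)) (pr2 s))).
  refine (concat _ (concat (HY (fun t => h (k t)) i1) _)).
  - refine (ap h (sigma_prop _ _ (fun x => leq_head_prop n x v) s (k i1) _)). cbn.
    refine (leq_antisym _ _ _ (pr1 (P i1))).
    refine (tr_rec _ _ (leq_prop _ _) _ (pr2 (pr2 (P i1)))). intros c.
    induction c as [l|l] using sum_rect.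
    + exact (leq_trans _ _ _ (leq_greatest _) l).
    + exact l.
  - refine (ap h (sigma_prop _ _ (fun x => leq_head_prop n x v) (k i0) _ _)). cbn.
    exact (leq_antisym _ _ (pr1 (pr2 (P i0))) (leq_least _)).
Defined.

(** The two projections with their types in weak head normal form. *)
Definition coordinates n (d : simplex (S n)) : interval × ipow n := pr1 d.
Definition inequalities n (d : simplex (S n)) :
  leq_head n (pr1 (coordinates n d)) (pr2 (coordinates n d)) × sorted n (pr2 (coordinates n d)) := pr2 d.
Definition head n (d : simplex (S n)) : interval := pr1 (coordinates n d).
Definition tail n (d : simplex (S n)) : simplex n :=
  existT (sorted n) (pr2 (coordinates n d)) (pr2 (inequalities n d)).
Definition head_leq n (d : simplex (S n)) : leq_head n (head n d) (pr1 (tail n d)) :=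
  pr1 (inequalities n d).
Definition cons n x (w : simplex n) (l : leq_head n x (pr1 w)) : simplex (S n) :=
  existT (sorted (S n)) (existT (fun _ => ipow n) x (pr1 w))
    (existT (fun _ => sorted n (pr2 (existT (fun _ => ipow n) x (pr1 w)))) l (pr2 w)).
Definition cons0 n (d : simplex n) : simplex (S n) := cons n i0 d (leq_head_least n (pr1 d)).

Lemma cons_eta n (d : simplex (S n)) : cons n (head n d) (tail n d) (head_leq n d) == d.
Proof.
  refine (sigT_rect (fun d : simplex (S n) => cons n (head n d) (tail n d) (head_leq n d) == d) (fun v s => _) d).
  revert s. refine (sigT_rect (fun v : interval × ipow n => forall s : sorted (S n) v, _) (fun x v s => _) v).
  exact (sigT_rect (fun s : leq_head n x v × sorted n v => cons n x ⟨v, pr2 s⟩ (pr1 s) ==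
    existT (sorted (S n)) (existT (fun _ => ipow n) x v) s)
    (fun l s => idpath _) s).
Defined.

(** With the tail fixed, [cone_const] moves the first coordinate to [i0]; the induction hypothesis
    then applies to [g] restricted along [cons0]. The point [z] is chosen before [Y] and [g],
    because a coherent witness needs one base point for all maps. *)
Lemma simplex_connected n :
  {z : simplex n & forall Y, is_const Y -> forall (g : simplex n -> Y) d, g d == g z}.
Proof.
  induction n as [|n IH] using nat_rect.
  - exact ⟨⟨tt, tt⟩, fun Y HY g d => ap g (inv (simplex0_path d))⟩.
  - refine ⟨cons0 n (pr1 IH), fun Y HY g d => concat (ap g (inv (cons_eta n d))) (concat _
      (pr2 IH Y HY (fun d => g (cons0 n d)) (tail n d)))⟩.
    exact (cone_const n _ Y HY (fun y => g (cons n (pr1 y) (tail n d) (pr2 y)))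
      ⟨head n d, head_leq n d⟩).
Defined.

Lemma cons_path n x y (p : x == y) (w w' : simplex n) (q : w == w') l l' :
  cons n x w l == cons n y w' l'.
Proof.
  induction p as [] using paths_rect. induction q as [] using paths_rect.
  exact (ap (cons n x w) (leq_head_prop _ _ _ l l')).
Defined.

Lemma cons0_tail n (d : simplex (S n)) (l : leq (head n d) i0) : cons0 n (tail n d) == d.
Proof.
  refine (concat _ (cons_eta n d)).
  exact (cons_path n _ _ (leq_antisym _ _ (leq_least _) l) _ _ (idpath _) _ _).
Defined.

(** A sorted vector that starts at 1 is constantly 1. Expressing this through [leq_head] lets the
    single point of the 0-simplex count as a last vertex too. *)
Lemma last_vertex n : {o : simplex n & leq_head n i1 (pr1 o) ×
  (forall d : simplex n, leq_head n i1 (pr1 d) -> o == d)}.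
Proof.
  induction n as [|n IH] using nat_rect.
  - exact ⟨⟨tt, tt⟩, ⟨tt, fun d _ => simplex0_path d⟩⟩.
  - refine ⟨cons n i1 (pr1 IH) (pr1 (pr2 IH)), ⟨leq_refl i1, fun d l => concat _ (cons_eta n d)⟩⟩.
    refine (cons_path n _ _ (leq_antisym _ _ l (leq_greatest _)) _ _ _ _ _).
    exact (pr2 (pr2 IH) (tail n d) (leq_head_trans n _ _ _ l (head_leq n d))).
Defined.

Definition vertex n : simplex n := pr1 (last_vertex n).

Definition vertex_path n (d : simplex (S n)) (l : leq i1 (head n d)) : vertex (S n) == d.
Proof. exact (pr2 (pr2 (last_vertex (S n))) d l). Defined.

Lemma endpoints_not_leq (l : leq i1 i0) : Empty_set.
Proof. exact (endpoints_distinct (leq_antisym _ _ (leq_least _) l)). Defined.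

Definition cons0_not_vertex n (d : simplex n) (p : cons0 n d == vertex (S n)) : Empty_set.
Proof.
  refine (endpoints_not_leq (transport (fun e => leq i1 (head n e)) (inv p) _)).
  exact (pr1 (pr2 (last_vertex (S n)))).
Defined.

(** [leq x i0] and [leq i1 x] are disjoint propositions, whereas [x == i0] and
    [x == i1] are propositions only because the interval is a set. *)
Lemma leq_decidable x (H : trunc (sum (x == i0) (x == i1))) : sum (leq x i0) (leq i1 x).
Proof.
  refine (tr_rec _ _ _ (fun c => _) H).
  - intros a b. induction a as [a|a] using sum_rect; induction b as [b|b] using sum_rect.
    + exact (ap (fun l => inl l) (leq_prop _ _ a b)).
    + exact (absurd (endpoints_not_leq (leq_trans _ _ _ b a))).
    + exact (absurd (endpoints_not_leq (leq_trans _ _ _ a b))).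
    + exact (ap (fun l => inr l) (leq_prop _ _ a b)).
  - induction c as [p|p] using sum_rect.
    + exact (inl (transport (fun y => leq x y) p (leq_refl x))).
    + exact (inr (transport (fun y => leq y x) p (leq_refl x))).
Defined.

(** Crisp induction: a family over crisp elements becomes an ordinary family
    under [csk], so that ordinary induction applies to it. *)
Definition sk_ap {A} {a b : A} (p : a == b) : sk_in a == sk_in b :=
  csk_out (paths_rect A a (fun b _ => csk (sk_in a == sk_in b)) (csk_in (idpath _)) b p).

Definition sk_map {A B} (f : A -> B) (v : sk A) : sk B := sk_rect A (fun _ => sk B) (fun a => sk_in (f a)) v.

Definition sk_iso {A B} (e : iso A B) : iso (sk A) (sk B) :=
  iso_make (sk_map (iso_fun e)) (sk_map (iso_inv e))
    (sk_rect B (fun v => sk_map (iso_fun e) (sk_map (iso_inv e) v) == v)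
      (fun b => sk_ap (iso_sec e b)))
    (sk_rect A (fun v => sk_map (iso_inv e) (sk_map (iso_fun e) v) == v)
      (fun a => sk_ap (iso_ret e a))).

(** Corresponds to [CrispPi]. *)
Definition crisp_pi {A : Type} (B : A -> U2) : Type := forall v : sk A, sk_rect A (fun _ => U2) B v.
Definition crisp_fun {A : Type} {B : A -> U2} (t : forall a, B a) : crisp_pi B :=
  fun v => sk_rect A (fun v => sk_rect A (fun _ => U2) B v) t v.

(** Uniqueness for [sk] is only propositional, so this composite is compared with the identity by
    [sk]-induction and function extensionality. *)
Definition sk_sections_eta D Y (P : Y -> Type) (s : {y : Y & sk D -> P y}) :
  existT (fun y => sk D -> P y) (pr1 s)
    (fun w => sk_rect D (fun _ => P (pr1 s)) (fun d => pr2 s (sk_in d)) w) == s.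
Proof.
  refine (concat (ap (existT (fun y => sk D -> P y) (pr1 s)) (funext _ _ _ (pr2 s) _)) (sigma_eta _ _ s)).
  exact (sk_rect D (fun w => sk_rect D (fun _ => P (pr1 s)) (fun d => pr2 s (sk_in d)) w == pr2 s w)
    (fun d => idpath (pr2 s (sk_in d)))).
Defined.

(** The sum over [Y] stays under [sk], so that [s], and with it the base point [pr1 s], is crisp
    where [csk_out] is applied; over an ordinary [y] that rule would not apply. *)
Definition sk_sections_iso D Y (P : Y -> Type) :
  iso (sk {y : Y & D -> csk (P y)}) (sk {y : Y & sk D -> P y}).
Proof.
  pose (f := fun s : {y : Y & D -> csk (P y)} => existT (fun y => sk D -> P y) (pr1 s)
    (fun w => sk_rect D (fun _ => P (pr1 s)) (fun d => csk_out (pr2 s d)) w)).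
  pose (g := fun s : {y : Y & sk D -> P y} => existT (fun y => D -> csk (P y)) (pr1 s)
    (fun d => csk_in (pr2 s (sk_in d)))).
  exact (iso_make (sk_map f) (sk_map g)
    (sk_rect _ (fun v => sk_map f (sk_map g v) == v) (fun s => sk_ap (sk_sections_eta D Y P s)))
    (sk_rect _ (fun v => sk_map g (sk_map f v) == v) (fun s => sk_ap (sigma_eta _ _ s)))).
Defined.

(** * Counting the points of the skeleton of a simplex *)

Definition decide (x : interval) : sum (leq x i0) (leq i1 x) :=
  leq_decidable x (csk_out (endpoints_csk x)).

(** The branches bind an ordinary [l], but [sk_ap] needs a crisp path; under [csk] the variable [l]
    counts as crisp. Each summand carries the path that identifies [d], so that later case
    distinctions only apply functions to it. *)
Definition split_simplex n (d : simplex (S n)) :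
  sum (sk_in (cons0 n (tail n d)) == sk_in d) (sk_in (vertex (S n)) == sk_in d) :=
  csk_out (sum_rect (fun _ => csk (sum (sk_in (cons0 n (tail n d)) == sk_in d) (sk_in (vertex (S n)) == sk_in d)))
    (fun l => csk_in (inl (sk_ap (cons0_tail n d l))))
    (fun l => csk_in (inr (sk_ap (vertex_path n d l))))
    (decide (head n d))).

Definition sk_cons0_not_vertex n (d : simplex n) (p : sk_in (cons0 n d) == sk_in (vertex (S n))) : Empty_set.
Proof. exact (cons0_not_vertex n d (ap (counit _) p)). Defined.

Definition sk_simplex_fun n G (g : sk (simplex (S n)) -> G) : G × (sk (simplex n) -> G) :=
  existT (fun _ => sk (simplex n) -> G) (g (sk_in (vertex (S n))))
    (fun w => sk_rect (simplex n) (fun _ => G) (fun d => g (sk_in (cons0 n d))) w).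

Definition sk_simplex_inv n G (s : G × (sk (simplex n) -> G)) (w : sk (simplex (S n))) : G :=
  sk_rect (simplex (S n)) (fun _ => G) (fun d =>
    sum_rect (fun _ => G) (fun _ => pr2 s (sk_in (tail n d))) (fun _ => pr1 s) (split_simplex n d)) w.

(** The decision is generalized to an arbitrary [c], so that nothing has to be known about its
    value: the wrong summand carries a path that contradicts the distinctness of the endpoints. *)
Definition sk_simplex_inv_vertex n G (s : G × (sk (simplex n) -> G)) :
  sk_simplex_inv n G s (sk_in (vertex (S n))) == pr1 s.
Proof.
  exact (sum_rect (fun c => sum_rect (fun _ => G) (fun _ => pr2 s (sk_in (tail n (vertex (S n)))))
      (fun _ => pr1 s) c == pr1 s)
    (fun p => absurd (sk_cons0_not_vertex _ _ p)) (fun _ => idpath (pr1 s))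
    (split_simplex n (vertex (S n)))).
Defined.

Definition sk_simplex_inv_cons0 n G (s : G × (sk (simplex n) -> G)) (d : simplex n) :
  sk_simplex_inv n G s (sk_in (cons0 n d)) == pr2 s (sk_in d).
Proof.
  exact (sum_rect (fun c => sum_rect (fun _ => G) (fun _ => pr2 s (sk_in (tail n (cons0 n d))))
      (fun _ => pr1 s) c == pr2 s (sk_in d))
    (* [tail n (cons0 n d)] computes to the pair of the projections of [d]. *)
    (fun _ => ap (pr2 s) (sk_ap (sigma_eta _ (fun v => sorted n v) d)))
    (fun p => absurd (sk_cons0_not_vertex _ _ (inv p)))
    (split_simplex n (cons0 n d))).
Defined.

Definition sk_simplex_inv_fun n G (g : sk (simplex (S n)) -> G) (d : simplex (S n)) :
  sk_simplex_inv n G (sk_simplex_fun n G g) (sk_in d) == g (sk_in d).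
Proof.
  exact (sum_rect (fun c => sum_rect (fun _ => G) (fun _ => g (sk_in (cons0 n (tail n d))))
      (fun _ => g (sk_in (vertex (S n)))) c == g (sk_in d))
    (fun p => ap g p) (fun p => ap g p) (split_simplex n d)).
Defined.

Lemma pair_path A B (s : A × B) (a : A) (b : B) (p : a == pr1 s) (q : b == pr2 s) :
  existT (fun _ => B) a b == s.
Proof.
  refine (concat (ap (fun a => existT (fun _ => B) a b) p) _).
  refine (concat (ap (existT (fun _ => B) (pr1 s)) q) _).
  exact (sigma_eta _ _ s).
Defined.

Definition sk_simplex_step n G :
  iso (sk (simplex (S n)) -> G) (G × (sk (simplex n) -> G)).
Proof.
  refine (iso_make (sk_simplex_fun n G) (sk_simplex_inv n G) (fun s => _) (fun g => _)).
  - refine (pair_path _ _ s _ _ (sk_simplex_inv_vertex n G s) (funext _ _ _ (pr2 s)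
      (sk_rect (simplex n) _ (fun d => _)))).
    exact (sk_simplex_inv_cons0 n G s d).
  - refine (funext _ _ _ g (sk_rect (simplex (S n)) _ (fun d => _))).
    exact (sk_simplex_inv_fun n G g d).
Defined.

Definition sk_simplex_zero G : iso (sk (simplex 0) -> G) (G × unit).
Proof.
  refine (iso_make (fun g => ⟨g (sk_in ⟨tt, tt⟩), tt⟩) (fun s _ => pr1 s) _ _).
  - refine (sigT_rect _ (fun u t => ap (existT (fun _ => unit) u) (unit_path _ _))).
  - intros g. refine (funext _ _ _ g (sk_rect _ _ (fun d => _))).
    exact (ap g (sk_ap (simplex0_path d))).
Defined.

(** The index [n] is crisp, as [sk (simplex n)] requires, but [G] is an ordinary variable: it will
    be the fibre over an ordinary [y]. The [csk] in the motive makes the index and the hypothesis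
    crisp inside the induction step. *)
Lemma sk_simplex_iso :
  crisp_pi (fun n => forall G, iso (sk (simplex n) -> G) (pow G (S n))).
Proof.
  refine (crisp_fun (fun n => csk_out (nat_rect
    (fun n => csk (forall G, iso (sk (simplex n) -> G) (pow G (S n))))
    (csk_in sk_simplex_zero)
    (fun n IH => csk_in (fun G => iso_trans _ _ _ (sk_simplex_step n G)
      (iso_sigma _ _ _ (fun _ => csk_out IH G)))) n))).
Defined.

(** * Simplices of the Čech complex *)

Definition fib {X Y} (f : X -> Y) (y : Y) : Type := {x : X & f x == y}.
Definition cech {X Y} (f : X -> Y) : Type := {y : Y & csk (fib f y)}.
Definition cech_simplices {X Y} (f : X -> Y) n : Type := sk (simplex n -> cech f).
Definition fiber_powers {X Y} (f : X -> Y) n : Type := {y : Y & pow (fib f y) (S n)}.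

(** The first coordinate of a map on [D] is constant by [K], and the second coordinates are
    transported into the fibre over its value at [d]. On a family that already lies over one [y],
    coherence of [K] makes this transport the identity. *)
Lemma sections_iso D d Y (P : Y -> Type) (K : coherent_const D d Y) :
  iso (D -> {y : Y & P y}) {y : Y & D -> P y}.
Proof.
  refine (iso_make
    (fun g => existT (fun y => D -> P y) (pr1 (g d))
      (fun i => transport P (pr1 K (fun i => pr1 (g i)) i) (pr2 (g i))))
    (fun s i => existT P (pr1 s) (pr2 s i)) _
    (fun g => funext _ _ _ _ (fun i => inv (sigma_transport _ P (g i) _ (pr1 K (fun i => pr1 (g i)) i))))).
  refine (sigT_rect _ (fun y h => ap (existT (fun y => D -> P y) y) (funext _ _ _ _ (fun i => _)))).
  exact (ap (fun p => transport P p (h i)) (pr2 K y i)).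
Defined.

Lemma skeletal_const : crisp_pi (fun Y : Type => is_skeletal Y -> is_const Y).
Proof.
  exact (crisp_fun (fun Y H => null_const Y (pr1 (skeletal_iff_null (sk_in Y)) H))).
Defined.

Lemma const_skeletal : crisp_pi (fun Y : Type => is_const Y -> iso (sk Y) Y).
Proof.
  exact (crisp_fun (fun Y H => equiv_iso _ _ _ (pr2 (skeletal_iff_null (sk_in Y)) (const_null Y H)))).
Defined.

Lemma fiber_powers_const X Y (HX : is_const X) (HY : is_const Y) (f : X -> Y) n :
  is_const (fiber_powers f n).
Proof.
  exact (const_sigma _ _ HY (fun y => const_pow _ (const_sigma _ _ HX (fun x => const_paths _ HY _ _)) _)).
Defined.

Lemma cech_fiber_powers :
  crisp_pi (fun X : Type => crisp_pi (fun Y : Type =>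
  crisp_pi (fun HX : is_skeletal X => crisp_pi (fun HY : is_skeletal Y =>
  crisp_pi (fun f : X -> Y => crisp_pi (fun n : nat =>
  iso (cech_simplices f n) (fiber_powers f n))))))).
Proof.
  refine (crisp_fun (fun X => crisp_fun (fun Y => crisp_fun (fun HX => crisp_fun (fun HY =>
    crisp_fun (fun f => crisp_fun (fun n => _))))))).
  pose (KX := skeletal_const (sk_in X) HX).
  pose (KY := skeletal_const (sk_in Y) HY).
  pose (K := make_coherent _ _ _ (pr2 (simplex_connected n) Y KY)).
  refine (iso_trans _ _ _ (sk_iso (sections_iso _ _ _ (fun y => csk (fib f y)) K)) _).
  refine (iso_trans _ _ _ (sk_sections_iso _ _ _) _).
  refine (iso_trans _ _ _ (sk_iso (iso_sigma _ _ _
    (fun y => sk_simplex_iso (sk_in n) (fib f y)))) _).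
  exact (const_skeletal (sk_in (fiber_powers f n)) (fiber_powers_const X Y KX KY f n)).
Defined.

(** * Iterated pullbacks and powers of fibres *)

Definition pullback {A B C} (g : A -> C) (h : B -> C) : Type := {a : A & {b : B & g a == h b}}.

Definition iterated_pullback_over {X Y : Type} (f : X -> Y) (n : nat) : {P : Type & P -> Y} :=
  nat_rect (fun _ => {P : Type & P -> Y}) (existT (fun P => P -> Y) X f)
    (fun _ IH => existT (fun P => P -> Y) (pullback (pr2 IH) f)
      (fun s => pr2 IH (pr1 s))) n.

Lemma concat_inv_concat A (a b c : A) (p : a == b) (q : a == c) :
  concat p (inv (concat (inv q) p)) == q.
Proof.
  induction p as [] using paths_rect. induction q as [] using paths_rect. exact (idpath _).
Defined.

Lemma inv_concat_inv_concat A (a b c : A) (p : a == b) (q : c == b) :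
  concat (inv (concat p (inv q))) p == q.
Proof.
  revert p. induction q as [] using paths_rect. intros p.
  induction p as [] using paths_rect. exact (idpath _).
Defined.

Lemma iso_times_unit A : iso A (A × unit).
Proof.
  refine (iso_make (fun a => ⟨a, tt⟩) pr1 _ (fun a => idpath a)).
  refine (sigT_rect _ (fun a u => ap (existT (fun _ => unit) a) (unit_path _ _))).
Defined.

(** Given [q : p a == y], the paths [r : p a == f b] correspond to the paths [f b == y] by composing
    [inv r] with [q]. The new factor comes last in the pullback but first in [pow], so the two
    factors are exchanged. *)
Lemma fib_pullback_iso X Y P (f : X -> Y) (p : P -> Y) y :
  iso (fib (fun s : pullback p f => p (pr1 s)) y) (fib f y × fib p y).
Proof.
  pose (pair := fun (a : P) (b : X) (r : p a == f b) (q : p a == y) =>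
    existT (fun s : pullback p f => p (pr1 s) == y) (existT (fun a => {b : X & p a == f b}) a
      (existT (fun b => p a == f b) b r)) q).
  pose (pair' := fun (b : X) (r : f b == y) (a : P) (q : p a == y) =>
    existT (fun _ : fib f y => fib p y) (existT (fun b => f b == y) b r)
      (existT (fun a => p a == y) a q)).
  refine (iso_make
    (fun s => pair' (pr1 (pr2 (pr1 s))) (concat (inv (pr2 (pr2 (pr1 s)))) (pr2 s)) (pr1 (pr1 s)) (pr2 s))
    (fun s => pair (pr1 (pr2 s)) (pr1 (pr1 s)) (concat (pr2 (pr2 s)) (inv (pr2 (pr1 s)))) (pr2 (pr2 s)))
    _ _).
  - intros s. induction s as [s t] using sigT_rect. induction s as [b r] using sigT_rect.
    induction t as [a q] using sigT_rect.
    exact (ap (fun r => pair' b r a q) (inv_concat_inv_concat _ _ _ _ q r)).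
  - intros s. induction s as [s q] using sigT_rect. induction s as [a s] using sigT_rect.
    induction s as [b r] using sigT_rect.
    exact (ap (fun r => pair a b r q) (concat_inv_concat _ _ _ _ q r)).
Defined.

Lemma fib_iterated_pullback X Y (f : X -> Y) n y :
  iso (fib (pr2 (iterated_pullback_over f n)) y) (pow (fib f y) (S n)).
Proof.
  induction n as [|n IH] using nat_rect.
  - exact (iso_times_unit _).
  - exact (iso_trans _ _ _ (fib_pullback_iso X Y _ f _ y) (iso_sigma _ _ _ (fun _ => IH))).
Defined.

Lemma total_fib_iso A Y (p : A -> Y) : iso A {y : Y & fib p y}.
Proof.
  refine (iso_make (fun a => existT (fib p) (p a) ⟨a, idpath (p a)⟩) (fun s => pr1 (pr2 s)) _
    (fun a => idpath a)).
  refine (sigT_rect _ (fun y => sigT_rect _ (fun a q => _))). cbn.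
  induction q as [] using paths_rect. exact (idpath _).
Defined.

(** Every type over [Y] is the sum of its fibres, so it is enough to compare fibres. *)
Lemma iterated_pullback_fiber_powers X Y (f : X -> Y) n :
  iso (pr1 (iterated_pullback_over f n)) (fiber_powers f n).
Proof.
  exact (iso_trans _ _ _ (total_fib_iso _ Y (pr2 (iterated_pullback_over f n)))
    (iso_sigma _ _ _ (fib_iterated_pullback X Y f n))).
Defined.

Lemma cech_iterated_pullback :
  crisp_pi (fun X : Type => crisp_pi (fun Y : Type =>
  crisp_pi (fun HX : is_skeletal X => crisp_pi (fun HY : is_skeletal Y =>
  crisp_pi (fun f : X -> Y => crisp_pi (fun n : nat =>
  equiv (cech_simplices f n) (pr1 (iterated_pullback_over f n)))))))).
Proof.
  refine (crisp_fun (fun X => crisp_fun (fun Y => crisp_fun (fun HX => crisp_fun (fun HY =>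
    crisp_fun (fun f => crisp_fun (fun n => _))))))).
  exact (iso_equiv _ _ (iso_trans _ _ _
    (cech_fiber_powers (sk_in X) (sk_in Y) (sk_in HX) (sk_in HY) (sk_in f) (sk_in n))
    (iso_sym _ _ (iterated_pullback_fiber_powers X Y f n)))).
Defined.

Lemma equiv_iterated_pullback_fiber_powers (X Y : Type) (f : X -> Y) n :
  equiv (pr1 (iterated_pullback_over f n)) (fiber_powers f n).
Proof. exact (iso_equiv _ _ (iterated_pullback_fiber_powers X Y f n)). Defined.

End Synthetic.

(** * Reading derivations *)

Ltac head t := lazymatch t with ?f _ => head f | _ => t end.

(** The constants and variables that may occur in a term to be read, with the most
    recent first. An entry of [extend] is a variable of the object theory; an
    entry of [define] is a definition with [arity] arguments whose body, read in
    a scope with [depth] lemmas, is [template]. *)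
Inductive scope : Type :=
| empty
| extend {A : Type} (a : A) (E : scope)
| define {A : Type} (a : A) (arity depth : nat) (template : term) (E : scope).

(** [args] lists the arguments from the last to the first, possibly more than [arity];
    the remaining variables of [template] are lemmas. *)
Definition expand (template : term) (arity shift : nat) (args : list term) : term :=
  let n := length args - arity in
  fold_right (fun a f => App f a)
    (subst (fun j => if j <? arity then List.nth j (skipn n args) Tt else #(j - arity + shift)) template)
    (firstn n args).

Ltac lookup E t :=
  lazymatch E with
  | extend t _ => constr:(Some 0)
  | extend _ ?E => lazymatch lookup E t with Some ?k => constr:(Some (S k)) | None => constr:(@None nat) end
  | define _ _ _ _ ?E => lookup E t
  | _ => constr:(@None nat)
  end.

Ltac lookup_definition E t :=
  lazymatch E with
  | extend _ ?E => lookup_definition E t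
  | define t ?k ?m ?u _ => constr:(Some (k, m, u))
  | define _ _ _ _ ?E => lookup_definition E t
  | _ => constr:(@None nat)
  end.

Ltac spine_length t :=
  lazymatch t with
  | ?f ?x =>
      let n := spine_length f in
      lazymatch type of x with Model => n | _ => constr:(S n) end
  | _ => constr:(0)
  end.

Ltac is_primitive h :=
  lazymatch h with
  | @paths_rect => constr:(true)
  | @sigT_rect => constr:(true)
  | @sum_rect => constr:(true)
  | @unit_rect => constr:(true)
  | @Empty_set_rect => constr:(true)
  | @nat_rect => constr:(true)
  | @sk_rect => constr:(true)
  | @csk_out => constr:(true)
  | @leq => constr:(true)
  | @tr_rec => constr:(true)
  | @tr_path => constr:(true)
  | @funext_equiv => constr:(true)
  | @leq_prop => constr:(true)
  | @leq_refl => constr:(true)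
  | @leq_trans => constr:(true)
  | @leq_antisym => constr:(true)
  | @leq_total => constr:(true)
  | @leq_least => constr:(true)
  | @leq_greatest => constr:(true)
  | @endpoints_distinct => constr:(true)
  | @skeletal_iff_null => constr:(true)
  | @endpoints_csk => constr:(true)
  | _ => match goal with
    | _ => let _ := match goal with _ => is_const h end in constr:(false)
    | _ => constr:(true)
    end
  end.

Ltac closed_body f := lazymatch f with fun _ => ?t => t end.

Ltac reify_args rec t :=
  lazymatch t with
  | ?f ?x =>
      let r := reify_args rec f in
      lazymatch type of x with
      | Model => r
      | _ => let x := rec x in constr:(x :: r)
      end
  | _ => constr:(@nil term)
  end.

(** Reads [t]. The [d] variables bound locally are in [E], the definitions and the
    [g] lemmas in [G]. Constants that are not in [G] are unfolded. *)
Ltac reify G g E d t :=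
  let reify0 t := reify G g E d t in
  let reify1 A B :=
    let x := fresh "x" in
    let f := constr:(fun x : A => ltac:(
      let b := eval cbv beta in (B x) in
      let b := reify G g (extend x E) (S d) b in exact b)) in
    closed_body f in
  let reify2 A B C :=
    let x := fresh "x" in
    let f := constr:(fun x : A => ltac:(
      let Bx := eval cbv beta in (B x) in
      let y := fresh "x" in
      let f := constr:(fun y : Bx => ltac:(
        let c := eval cbv beta in (C x y) in
        let c := reify G g (extend y (extend x E)) (S (S d)) c in exact c)) in
      let b := closed_body f in exact b)) in
    closed_body f in
  lazymatch t with
  | forall x : ?A, @?B x =>
      let a := reify0 A in let b := reify1 A B in constr:(Pi a b)
  | fun x : ?A => @?B x =>
      let a := reify0 A in let b := reify1 A B in constr:(Lam a b)
  | @sigT ?A ?B =>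
      let a := reify0 A in let b := reify1 A B in constr:(Sig a b)
  | @existT ?A ?B ?x ?y =>
      let a := reify0 A in let b := reify1 A B in
      let x := reify0 x in let y := reify0 y in
      constr:(cast (Sig a b) (Pair x y))
  | @existT ?A ?B ?x =>
      let t := eval cbv beta in (fun y : B x => @existT A B x y) in reify0 t
  | @pr1 ?A _ ?p => let a := reify0 A in let p := reify0 p in constr:(Fst a p)
  | @sigT_rect ?A ?B ?C ?f ?p =>
      let C := reify1 (@sigT A B) C in
      let f := reify2 A B f in
      let p := reify0 p in constr:(Split C f p)
  | @paths ?A ?x ?y =>
      let a := reify0 A in let x := reify0 x in let y := reify0 y in constr:(Id a x y)
  | @idpath ?A ?x => let x := reify0 x in constr:(Refl x)
  | @paths_rect ?A ?a ?C ?c ?b ?p =>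
      let C := reify2 A (@paths A a) C in
      let c := reify0 c in
      let p := reify0 p in constr:(J C c p)
  | @sigT_rect ?A ?B ?C ?f => reify0 constr:(fun p : @sigT A B => @sigT_rect A B C f p)
  | @sum_rect ?A ?B ?C ?l ?r => reify0 constr:(fun s : sum A B => @sum_rect A B C l r s)
  | sk_rect ?A ?C ?f => reify0 constr:(fun v : sk A => sk_rect A C f v)
  | sum ?A ?B => let a := reify0 A in let b := reify0 B in constr:(Coprod a b)
  | @inl ?A ?B ?x =>
      let a := reify0 A in let b := reify0 B in let x := reify0 x in
      constr:(cast (Coprod a b) (Inl x))
  | @inr ?A ?B ?x =>
      let a := reify0 A in let b := reify0 B in let x := reify0 x in
      constr:(cast (Coprod a b) (Inr x))
  | @inl ?A ?B => reify0 constr:(fun x : A => @inl A B x)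
  | @inr ?A ?B => reify0 constr:(fun x : B => @inr A B x)
  | @sum_rect ?A ?B ?C ?l ?r ?s =>
      let C := reify1 (sum A B) C in
      let l := reify1 A l in
      let r := reify1 B r in
      let s := reify0 s in constr:(Case C l r s)
  | unit => constr:(Unit)
  | tt => constr:(Tt)
  | unit_rect ?C ?x ?u =>
      let C := reify1 unit C in let x := reify0 x in let u := reify0 u in
      constr:(UnitInd C x u)
  | Empty_set => constr:(Empty)
  | Empty_set_rect ?C ?e =>
      let C := reify1 Empty_set C in let e := reify0 e in constr:(EmptyInd C e)
  | nat => constr:(Nat)
  | O => constr:(Zero)
  | S ?n => let n := reify0 n in constr:(Succ n)
  | nat_rect ?C ?z ?s ?n =>
      let z := reify0 z in
      let s := reify2 nat C s in
      let C := reify1 nat C in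
      let n := reify0 n in constr:(NatInd C z s n)
  | sk ?A => let a := reify0 A in constr:(Sk a)
  | @sk_in ?A ?x => let x := reify0 x in constr:(SkIn x)
  | sk_rect ?A ?C ?f ?v =>
      let C := reify1 (sk A) C in
      let f := reify1 A f in
      let v := reify0 v in constr:(SkLet C f v)
  | csk ?A => let a := reify0 A in constr:(Csk a)
  | @csk_in ?A ?x => let x := reify0 x in constr:(CskIn x)
  | @csk_out ?A ?x => let x := reify0 x in constr:(CskOut x)
  (* These are coded levels: [0] is the level 0, [1] is [i], and [5 = 2 * 2 + 1] is [i + 2]. *)
  | U0 => constr:(Univ 0)
  | U2 => constr:(Univ 5)
  | Type => constr:(Univ 1)
  | @interval _ => constr:(Delta1)
  | @i0 _ => constr:(D0)
  | @i1 _ => constr:(D1)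
  | @leq _ ?x ?y => let x := reify0 x in let y := reify0 y in constr:(Le x y)
  | @trunc _ ?A => let a := reify0 A in constr:(Trunc a)
  | @tr_in _ _ ?x => let x := reify0 x in constr:(TrIn x)
  | @tr_path _ _ ?x ?y => let x := reify0 x in let y := reify0 y in constr:(TrPath x y)
  | @tr_rec _ _ _ ?h ?f ?x =>
      let h := reify0 h in let f := reify0 f in let x := reify0 x in
      constr:(TrRec h f x)
  | @funext_equiv _ => constr:(Ax (Funext 1))
  | @leq_prop _ => constr:(Ax LeProp)
  | @leq_refl _ => constr:(Ax LeRefl)
  | @leq_trans _ => constr:(Ax LeTrans)
  | @leq_antisym _ => constr:(Ax LeAntisym)
  | @leq_total _ => constr:(Ax LeTotal)
  | @leq_least _ => constr:(Ax LeLeast)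
  | @leq_greatest _ => constr:(Ax LeGreatest)
  | @endpoints_distinct _ => constr:(Ax EndpointsDistinct)
  | @skeletal_iff_null _ => constr:(Ax (SkeletalIffNull 1))
  | @endpoints_csk _ => constr:(Ax EndpointsCsk)
  | _ =>
    let h := head t in
    let app _ :=
      lazymatch t with
      | ?f ?x => let f := reify0 f in let x := reify0 x in constr:(App f x)
      | _ => fail 0 "cannot reify" t
      end in
    lazymatch is_primitive h with
    | true =>
        lazymatch t with
        | h => lazymatch lookup E h with Some ?k => constr:(Var k) | _ => fail 0 "cannot reify" t end
        | _ => app ()
        end
    | false =>
      let unfolded _ :=
        let t := eval unfold h in t in
        let t := eval cbv beta zeta in t in
        reify0 t in
      lazymatch lookup_definition G h with
      | Some (?k, ?m, ?u) =>
        let n := spine_length t in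
        lazymatch eval cbv in (k <=? n) with
        | true =>
          let args := reify_args reify0 t in
          constr:(expand u k (d + (g - m)) args)
        | false => unfolded ()
        end
      | None =>
        lazymatch lookup G h with
        | Some ?k => lazymatch t with h => constr:(Var (d + k)) | _ => app () end
        | None =>
          let M := lazymatch goal with M : Model |- _ => M end in
          let hM := match goal with _ => constr:(h M) | _ => constr:(tt) end in
          lazymatch lookup G hM with
          | Some ?k => lazymatch t with hM => constr:(Var (d + k)) | _ => app () end
          | None => unfolded ()
          end
        end
      end
    end
  end.

Ltac reify_template G g E d t :=
  lazymatch t with
  | fun x : ?A => @?B x =>
      let y := fresh "x" in
      let f := constr:(fun y : A => ltac:(
        let b := eval cbv beta in (B y) in
        let r := reify_template G g (extend y E) (S d) b in exact r)) in
      lazymatch f with fun _ => (?k, ?b) => constr:((S k, b)) end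
  | _ => let b := reify G g E d t in constr:((0, b))
  end.

(** A lemma is read into a variable, which is opaque; a definition is expanded
    where it is used. Only the latter may occur in the statement of a lemma. *)
Inductive entries : Type :=
| start
| with_lemma {A : Type} (a : A) (L : entries)
| with_definition {A : Type} (a : A) (L : entries).

Ltac applied l := match goal with M : Model |- _ => constr:(l M) | _ => l end.

Ltac unfolded t :=
  let h := head t in
  let t := eval unfold h in t in
  eval cbv beta zeta in t.

Ltac reify_entries L k :=
  lazymatch L with
  | start => k empty 0 (@nil (term * term))
  | with_definition ?l ?L =>
      reify_entries L ltac:(fun G g acc =>
        let l := applied l in
        let t := unfolded l in
        let r := reify_template G g empty 0 t in
        lazymatch r with
        | (?n, ?u) =>
          let h := head l in
          let v := fresh "template" in
          pose (v := u);
          k constr:(define h n g v G) g acc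
        end)
  | with_lemma ?l ?L =>
      reify_entries L ltac:(fun G g acc =>
        let l := applied l in
        let T := type of l in
        let T := eval cbv beta zeta in T in
        let T := reify G g empty 0 T in
        let t := unfolded l in
        let t := reify G g empty 0 t in
        let v := fresh "proof" in
        let w := fresh "statement" in
        pose (v := t); pose (w := T);
        k constr:(extend l G) constr:(S g) constr:((v, w) :: acc))
  end.

Notation "L ⊕ a" := (with_lemma a L) (at level 50, left associativity, only parsing).
Notation "L ⊙ a" := (with_definition a L) (at level 50, left associativity, only parsing).

(** A constant is expanded with [⊙] also when its arguments have to be crisp, since its statement
    with ordinary products would be ill typed, or when its statement mentions a lemma, as those
    about [vertex] do. Lemmas with crisp hypotheses are stated by [crisp_pi]. *)
Definition reified : list (term * term) := ltac:(
  let f := constr:(fun M : Model => ltac:(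
    let L := constr:(
      start ⊕ @happly_funext ⊙ @iso ⊙ @iso_fun ⊙ @iso_inv ⊙ @iso_sec ⊙ @iso_ret ⊙ @iso_make
      ⊕ @iso_sym ⊕ @iso_trans ⊕ @iso_equiv ⊕ @equiv_iso ⊕ @iso_sigma ⊕ @null_const ⊕ @const_null
      ⊕ @sigma_eta ⊕ @sigma_transport ⊕ @const_sigma ⊕ @concat_inv ⊕ @make_coherent
      ⊕ @idpath_concat ⊕ @const_natural ⊕ @const_paths ⊙ @pow ⊕ @unit_path ⊕ @const_pow
      ⊕ @sigma_prop ⊕ @meet_leq ⊕ @meet ⊙ @ipow ⊙ @leq_head ⊙ @sorted ⊙ @simplex
      ⊕ @simplex0_path ⊕ @leq_head_prop ⊙ @leq_head_least ⊕ @leq_head_trans ⊕ @cone_const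
      ⊙ @coordinates ⊙ @inequalities ⊙ @head ⊙ @tail ⊙ @head_leq ⊙ @cons ⊙ @cons0 ⊕ @cons_eta
      ⊕ @simplex_connected ⊕ @cons_path ⊕ @cons0_tail ⊕ @last_vertex ⊙ @vertex ⊙ @vertex_path
      ⊕ @endpoints_not_leq ⊙ @cons0_not_vertex ⊕ @leq_decidable ⊙ @sk_ap ⊙ @sk_iso
      ⊙ @sk_sections_eta ⊙ @sk_sections_iso ⊙ @split_simplex ⊙ @sk_cons0_not_vertex
      ⊙ @sk_simplex_fun ⊙ @sk_simplex_inv ⊙ @sk_simplex_inv_vertex ⊙ @sk_simplex_inv_cons0
      ⊙ @sk_simplex_inv_fun ⊕ @pair_path ⊙ @sk_simplex_step ⊙ @sk_simplex_zero ⊕ @sk_simplex_iso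
      ⊙ @fib ⊕ @sections_iso ⊕ @skeletal_const ⊕ @const_skeletal ⊕ @fiber_powers_const
      ⊕ @cech_fiber_powers ⊕ @concat_inv_concat ⊕ @inv_concat_inv_concat ⊕ @iso_times_unit
      ⊕ @fib_pullback_iso ⊕ @fib_iterated_pullback ⊕ @total_fib_iso
      ⊕ @iterated_pullback_fiber_powers ⊕ @cech_iterated_pullback
      ⊕ @equiv_iterated_pullback_fiber_powers) in
    reify_entries L ltac:(fun G g acc => exact acc))) in
  let r := closed_body f in
  exact (rev_append r [])).

(** The fuel 1000 bounds both the depth of inference and that of reduction; soundness holds for any
    amount. *)
Lemma check_reified : check_lemmas 1000 [] reified = true.
Proof. vm_cast_no_check (eq_refl true). Qed.

(** The level [1] stands for [i]; the variables [#7] and [#6] are the last two lemmas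
    of [reified]. *)
Theorem proposition4p2p13 (i : nat) :
  inhabited_in (cech_context i)
    (Equiv (CechSimplices #5 #4 #1 #0) (IteratedPullback i #5 #4 #1 #0)) /\
  inhabited_in (cech_context i)
    (Equiv (IteratedPullback i #5 #4 #1 #0) (FiberPowers i #5 #4 #1 #0)).
Proof.
  split.
  (* A crisp product is a product over [Sk], so each argument enters as [SkIn a], on which [SkLet]
     computes. The substitution [s] reaches only variables of lemmas, none of which occurs in the
     statement, and [level i 1] computes to [i]; hence [H] is the goal up to computation. *)
  - destruct (check_derivation_sound i 1000 reified (cech_context 1)
      (fold_left (fun f a => App f (SkIn a)) [#5; #4; #3; #2; #1; #0] #7)
      (Equiv (CechSimplices #5 #4 #1 #0) (IteratedPullback 1 #5 #4 #1 #0)) check_reified) as [s H];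
      [vm_cast_no_check (eq_refl true) | exact H].
  - destruct (check_derivation_sound i 1000 reified (cech_context 1)
      (fold_left App [#5; #4; #1; #0] #6)
      (Equiv (IteratedPullback 1 #5 #4 #1 #0) (FiberPowers 1 #5 #4 #1 #0)) check_reified) as [s H];
      [vm_cast_no_check (eq_refl true) | exact H].
Qed.
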